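(* Let $\mu\colon\mathbb R\to\mathbb C$ and $\nu\colon\mathbb R\to[0,\infty)$ be as in the context: continuous, with $|\mu|$ and $\nu$ even and positive almost everywhere, $|\mu|/\sqrt{\nu}$ strictly decreasing on $\mathbb R_+=[0,+\infty)$, $\Lambda x=\mu x$ mapping $\mathcal W$ into $L_2(\mathbb R)$, and $f(s)\to+\infty$ as $s\to+\infty$, where $$f(s)=\int_{|t|\le s}\left(\frac{\sqrt{\nu(s)}}{|\mu(s)|}\frac{|\mu(t)|}{\sqrt{\nu(t)}}-1\right)\nu(t)\,dt .$$ For $\delta>0$ let $t_\delta$ be the unique solution of the equation $f(s)=\delta^{-2}$. Then for all $\delta>0$ $$E(\Lambda,W,\delta)=\delta\biggl(\int_{|t|\le t_\delta}|\mu(t)|^2\biggl(1-\frac{\sqrt{\nu(t)}}{|\mu(t)|}\frac{|\mu(t_\delta)|}{\sqrt{\nu(t_\delta)}}\biggr)\,dt\biggr)^{1/2}.$$ Moreover, the method $$\varphi(y_\xi)(t)=\left(1-\frac{\sqrt{\nu(t)}}{|\mu(t)|}\frac{|\mu(t_\delta)|}{\sqrt{\nu(t_\delta)}}\right)_+\mu(t)\,y_\xi(t)$$ is optimal, where $a_+=\max\{a,0\}$.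
   Context: All functions in $L_2(\mathbb R)$ are complex-valued. Let $\nu$ be a continuous function on $\mathbb R$, positive almost everywhere. Let $\mathcal W$ be the set of $x\in L_2(\mathbb R)$ with $\int_{\mathbb R}\nu(t)|x(t)|^2\,dt<\infty$, and let $$W=\Bigl\{x\in\mathcal W:\int_{\mathbb R}\nu(t)|x(t)|^2\,dt\le1\Bigr\}.$$ Let $\mu$ be continuous on $\mathbb R$ and such that the operator $\Lambda x=\mu x$ (pointwise multiplication) maps $\mathcal W$ into $L_2(\mathbb R)$. Assumptions: $|\mu|$ and $\nu$ are even, $|\mu(t)|>0$ almost everywhere, and $|\mu|/\sqrt{\nu}$ is strictly decreasing on $\mathbb R_+=[0,+\infty)$ (if $\nu(0)=0$, the quotient may be infinite or undefined at the single point $t=0$). The function $f$ in the claim is assumed to satisfy $f(s)\to+\infty$ as $s\to+\infty$; the equation $f(s)=\delta^{-2}$ then has a unique solution $t_\delta>0$ for each $\delta>0$. Random functions: $\mathbb M$ denotes expectation and $\mathbb D$ variance, $\mathbb Dy_\xi(t)=\mathbb M|y_\xi(t)-\mathbb My_\xi(t)|^2$. For $\delta>0$ and $x\in W$, $Y_\delta(x)$ is the set of random functions $y_\xi$ with values in $L_2(\mathbb R)$ such that $\mathbb My_\xi(t)=x(t)$ and $\mathbb Dy_\xi(t)\le\delta^2$ for (almost) all $t\in\mathbb R$, and for which interchange of expectation and integration is allowed in the sense that $$\mathbb M\int_{\mathbb R}p(t)y_\xi(t)\,dt=\int_{\mathbb R}p(t)\,\mathbb My_\xi(t)\,dt\quad\text{for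 all }p\in L_2(\mathbb R),\qquad \mathbb M\int_{\mathbb R}|y_\xi(t)|^2\,dt=\int_{\mathbb R}\mathbb M|y_\xi(t)|^2\,dt.$$ A recovery method is an arbitrary mapping $\varphi\colon L_2(\mathbb R)\to L_2(\mathbb R)$. Its error is $$e(\Lambda,W,\delta,\varphi)=\Bigl(\sup_{x\in W,\ y_\xi\in Y_\delta(x)}\mathbb M\bigl(\|\Lambda x-\varphi(y_\xi)\|_{L_2(\mathbb R)}^2\bigr)\Bigr)^{1/2}.$$ The error of optimal recovery is $E(\Lambda,W,\delta)=\inf_{\varphi\colon L_2(\mathbb R)\to L_2(\mathbb R)}e(\Lambda,W,\delta,\varphi)$, and a method $\varphi$ is called optimal if it attains this infimum. *)

(* Defs.v *)
#[warnings="-all"] From HB Require Import structures.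
#[warnings="-all"] From mathcomp Require Import all_boot all_order all_algebra.
#[warnings="-all"] From mathcomp Require Import all_classical all_reals all_analysis.
#[warnings="-all"] From mathcomp Require Import complex.

(* MathComp-Analysis, over an arbitrary R : realType.  Complex numbers are
   R[i] from real-closed, with the real-valued modulus normc. *)

Set Implicit Arguments.
Unset Strict Implicit.
Unset Printing Implicit Defensive.
Import Order.TTheory GRing.Theory Num.Theory numFieldNormedType.Exports.
Import ComplexField.Normc.
Local Open Scope classical_set_scope.
Local Open Scope ring_scope.

(* R[i] carries no sigma-algebra in the libraries, so measurability,
   integrability and integrals are taken componentwise. *)
Definition cmeasurable (R : realType) (d : measure_display)
    (T : measurableType d) (f : T -> R[i]) : Prop :=
  measurable_fun setT (fun x => complex.Re (f x)) /\
  measurable_fun setT (fun x => complex.Im (f x)).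

Definition cintegrable (R : realType) (d : measure_display)
    (T : measurableType d) (m : {measure set T -> \bar R}) (f : T -> R[i]) :
    Prop :=
  m.-integrable setT (fun x => (complex.Re (f x))%:E) /\
  m.-integrable setT (fun x => (complex.Im (f x))%:E).

Definition cintegral (R : realType) (d : measure_display)
    (T : measurableType d) (m : {measure set T -> \bar R}) (f : T -> R[i]) :
    R[i] :=
  ((\int[m]_x complex.Re (f x)) +i* (\int[m]_x complex.Im (f x)))%C.

Definition cexpectation (R : realType) (d : measure_display)
    (T : measurableType d) (P : probability T R) (X : T -> R[i]) : R[i] :=
  cintegral P X.

Definition cvariance (R : realType) (d : measure_display)
    (T : measurableType d) (P : probability T R) (X : T -> R[i]) : \bar R :=
  (\int[P]_w (normc (X w - cexpectation P X) ^+ 2)%:E)%E.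

Definition L2norm (R : realType) (x : R -> R[i]) : \bar R :=
  ('N[lebesgue_measure]_2%:E[EFin \o (fun t => normc (x t))])%E.

(* Elements of L_2(R) are handled through their representatives; Borel
   representatives suffice, since every class contains one. *)
Definition L2 (R : realType) : set (R -> R[i]) :=
  [set x | cmeasurable x /\ (L2norm x < +oo)%E].

Definition weighted_energy (R : realType) (nu : R -> R) (x : R -> R[i]) :
    \bar R :=
  (\int[lebesgue_measure]_t (nu t * normc (x t) ^+ 2)%:E)%E.

Definition weighted_space (R : realType) (nu : R -> R) : set (R -> R[i]) :=
  [set x | L2 x /\ (weighted_energy nu x < +oo)%E].

Definition weighted_ball (R : realType) (nu : R -> R) : set (R -> R[i]) :=
  [set x | weighted_space nu x /\ (weighted_energy nu x <= 1)%E].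

Definition mul_op (R : realType) (mu : R -> R[i]) (x : R -> R[i]) : R -> R[i] :=
  fun t => mu t * x t.

(* The set Y_delta(x) of admissible observations over the probability space
   (T, P).  A random function with values in L_2(R) is a jointly measurable
   y : T x R -> C all of whose paths lie in L_2(R).  In the first interchange
   condition the left-hand expectation is required to exist; the second is an
   identity in [0, +oo]. *)
Definition observations (R : realType) (d : measure_display)
    (T : measurableType d) (P : probability T R) (delta : R)
    (x : R -> R[i]) : set (T -> R -> R[i]) :=
  [set y |
    [/\ cmeasurable (fun z : T * R => y z.1 z.2),
        forall w, L2 (y w),
        {ae lebesgue_measure, forall t : R,
          [/\ cintegrable P (fun w => y w t),
              cexpectation P (fun w => y w t) = x t &
              (cvariance P (fun w => y w t) <= (delta ^+ 2)%:E)%E]},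
        forall p : R -> R[i], L2 p ->
          let pairing w := cintegral lebesgue_measure (fun t => p t * y w t) in
          cintegrable P pairing /\
          cexpectation P pairing =
            cintegral lebesgue_measure
              (fun t => p t * cexpectation P (fun w => y w t)) &
        (\int[P]_w \int[lebesgue_measure]_t (normc (y w t) ^+ 2)%:E =
         \int[lebesgue_measure]_t \int[P]_w (normc (y w t) ^+ 2)%:E)%E]].

(* Arbitrary maps L_2(R) -> L_2(R): on representatives, maps that preserve
   L_2(R) and respect almost everywhere equality. *)
Definition recovery_method (R : realType) :
    set ((R -> R[i]) -> (R -> R[i])) :=
  [set phi |
    (forall x, L2 x -> L2 (phi x)) /\
    (forall x x', L2 x -> L2 x' ->
      ae_eq lebesgue_measure setT x x' ->
      ae_eq lebesgue_measure setT (phi x) (phi x'))].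

(* phi is not assumed measurable; the integral of a nonnegative function is
   the supremum of the integrals of the simple functions below it, i.e. the
   expectation is a lower integral when the integrand is not measurable. *)
Definition mean_square_errors (R : realType) (mu : R -> R[i]) (nu : R -> R)
    (delta : R) (phi : (R -> R[i]) -> (R -> R[i])) : set (\bar R) :=
  [set r | exists x, weighted_ball nu x /\
    exists (d : measure_display) (T : measurableType d)
      (P : probability T R) (y : T -> R -> R[i]),
      observations P delta x y /\
      r = (\int[P]_w (L2norm (fun t => mul_op mu x t - phi (y w) t)%R ^+ 2))%E].

Definition method_error (R : realType) (mu : R -> R[i]) (nu : R -> R)
    (delta : R) (phi : (R -> R[i]) -> (R -> R[i])) : \bar R :=
  (ereal_sup (mean_square_errors mu nu delta phi) `^ 2^-1)%E.

Definition optimal_error (R : realType) (mu : R -> R[i]) (nu : R -> R)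
    (delta : R) : \bar R :=
  ereal_inf [set method_error mu nu delta phi | phi in @recovery_method R].

Definition optimal_method (R : realType) (mu : R -> R[i]) (nu : R -> R)
    (delta : R) (phi : (R -> R[i]) -> (R -> R[i])) : Prop :=
  recovery_method phi /\
  method_error mu nu delta phi = optimal_error mu nu delta.

Definition quotient (R : realType) (mu : R -> R[i]) (nu : R -> R) (t : R) : R :=
  normc (mu t) / Num.sqrt (nu t).

(* If nu 0 = 0 the point 0 is excluded, the quotient being infinite or
   undefined there.  At s > 0 nothing is excluded: as a / 0 = 0 and quotients
   are nonnegative, strict decrease forces nu s != 0 for every s > 0. *)
Definition quotient_decreasing (R : realType) (mu : R -> R[i]) (nu : R -> R) :
    Prop :=
  forall s t : R, 0 <= s -> s < t -> (s = 0 -> nu 0 != 0) ->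
    quotient mu nu t < quotient mu nu s.

Definition level (R : realType) (mu : R -> R[i]) (nu : R -> R) (s : R) : R :=
  \int[lebesgue_measure]_(t in [set t | `|t| <= s])
    ((Num.sqrt (nu s) / normc (mu s) * (normc (mu t) / Num.sqrt (nu t)) - 1)
     * nu t).

(* Main.v *)
Require Import Defs.
From HB Require Import structures.
From mathcomp Require Import all_boot all_order all_algebra.
From mathcomp Require Import all_classical all_reals all_analysis.
From mathcomp Require Import measurable_realfun complex.
From mathcomp Require Import ring lra.

Set Implicit Arguments.
Unset Strict Implicit.
Unset Printing Implicit Defensive.
Import Order.TTheory GRing.Theory Num.Theory numFieldNormedType.Exports.
Import ComplexField.Normc.
Local Open Scope classical_set_scope.
Local Open Scope ring_scope.

(** Write c for the value of |mu| / sqrt nu at the cutoff t_delta, and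
    I = int_{|t| <= t_delta} (|mu|^2 - c |mu| sqrt nu), so that the claimed
    error is delta sqrt I.  Since |mu| / sqrt nu decreases, c sqrt nu <= |mu|
    inside [-t_delta, t_delta] and c sqrt nu >= |mu| outside.

    The proposed method multiplies the observation by a mu, where
    a |mu| = g := max (|mu| - c sqrt nu, 0).  By Tonelli and unbiasedness its
    risk at x is at most
      int (|mu| - g)^2 |x|^2 + delta^2 int g^2
        <= c^2 int nu |x|^2 + delta^2 int g^2 <= c^2 + delta^2 int g^2,
    because |mu| - g = min (|mu|, c sqrt nu).  The equation
    f(t_delta) = 1 / delta^2 is exactly what turns the last expression into
    delta^2 I ([shrink_risk_balance], [shrink_error]).

    Conversely, no method has a smaller risk.  For a single real unknown x with
    |x| <= r, let the observation be 0 with probability 1 - p and x / p with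
    probability p = r^2 / (r^2 + delta^2).  It is unbiased with variance at most
    delta^2, and where it is 0 the sign of x is invisible, so some choice of
    sign costs at least (1 - p) r^2.  Here the amplitude varies with t.  The
    line is cut into finitely many blocks, each with an independent sign and its
    own probability p = k / N, and all blocks share one uniform draw w in
    {0, ..., N - 1}: block k is shown if and only if w < k.  Flipping the sign
    of a hidden block leaves the whole observation unchanged, so by the
    parallelogram law the average error over all signs is at least |mu x|^2
    there ([hidden_sign_error]); hence some sign pattern has risk at least
    delta^2 int |mu|^2 k / N ([random_signs_bound]).  With k / N close to
    1 - c sqrt nu / |mu| the squared amplitude delta^2 k / (N - k) is at most
    delta^2 (|mu| / (c sqrt nu) - 1), whose nu-energy is
    delta^2 f(t_delta) = 1, and the bound tends to delta^2 I as N grows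
    ([recovery_error_ge]).

    Existence and uniqueness of t_delta follow from
    f(s) = (1 / c(s)) int_{|t| <= s} |mu| sqrt nu - int_{|t| <= s} nu, where
    c(s) = |mu(s)| / sqrt nu(s): this is continuous for s > 0, small near 0,
    unbounded, and strictly increasing where it is positive ([level_root]). *)

(** * Complex-valued square-integrable functions *)

Section modulus.
Context {R : realType}.
Implicit Types z w : R[i].

Lemma normcK z : normc z ^+ 2 = complex.Re z ^+ 2 + complex.Im z ^+ 2.
Proof. by case: z => a b; rewrite /normc sqr_sqrtr// addr_ge0// sqr_ge0. Qed.

Lemma modulus_ge0 z : 0 <= normc z.
Proof. by case: z => a b; rewrite /normc sqrtr_ge0. Qed.

Lemma modulus_real (a : R) : normc (a%:C%C) = `|a|.
Proof. by rewrite /normc /= expr0n addr0 sqrtr_sqr. Qed.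

Lemma parallelogram z w :
  normc (z + w) ^+ 2 + normc (z - w) ^+ 2 = 2 * (normc z ^+ 2 + normc w ^+ 2).
Proof. by case: z w => a b [c e]; rewrite !normcK /=; ring. Qed.

Lemma normc_ge_absRe z : `|complex.Re z| <= normc z.
Proof.
rewrite -ler_sqr ?nnegrE ?modulus_ge0//.
by rewrite normcK real_normK ?num_real// lerDl sqr_ge0.
Qed.

Lemma normc_ge_absIm z : `|complex.Im z| <= normc z.
Proof.
rewrite -ler_sqr ?nnegrE ?modulus_ge0//.
by rewrite normcK real_normK ?num_real// lerDr sqr_ge0.
Qed.

Lemma modulusE z : `|z| = (normc z)%:C%C.
Proof. by case: z. Qed.

End modulus.

Section continuity.
Context {R : realType}.
Variable f : R -> R[i].
Hypothesis f_continuous : continuous (f : R -> R[i]^o).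

(** The topology on R[i] comes from its R[i]-valued norm, so a real-valued
    function that is 1-Lipschitz for the real modulus has to be handled with
    radii of the form e%:C. *)
Lemma continuous_cmod (g : R[i] -> R) :
  (forall z w, `|g z - g w| <= normc (z - w)) -> continuous (g \o f).
Proof.
move=> g_lip t; apply/cvgrPdist_lt => e e0.
have ft : f @ t --> (f t : R[i]^o) by exact: f_continuous.
have := proj1 (@cvgrPdist_lt _ (R[i]^o : pseudoMetricNormedZmodType R[i])
  _ _ _ _ _) ft (e%:C%C).
rewrite ltcR => /(_ _ e0); apply: filterS => s /=.
rewrite modulusE ltcR; apply: le_lt_trans; exact: g_lip.
Qed.

Lemma continuous_Re : continuous (fun t => complex.Re (f t)).
Proof.
apply: continuous_cmod => z w; apply: le_trans (normc_ge_absRe _).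
by case: z w => ? ? [].
Qed.

Lemma continuous_Im : continuous (fun t => complex.Im (f t)).
Proof.
apply: continuous_cmod => z w; apply: le_trans (normc_ge_absIm _).
by case: z w => ? ? [].
Qed.

Lemma continuous_normc : continuous (fun t => normc (f t)).
Proof.
have triangle z w : normc z - normc w <= normc (z - w).
  by rewrite lerBlDr -{1}(subrK w z) le_normcD.
apply: continuous_cmod => z w; rewrite ler_norml lerNl opprB !triangle andbT.
by rewrite -(normcN (z - w)) opprB triangle.
Qed.

End continuity.

Section cmeasurable_theory.
Context {R : realType} {d : measure_display} {T : measurableType d}.
Implicit Types f g : T -> R[i].

Lemma measurable_normc_sqr f : cmeasurable f ->
  measurable_fun setT (fun x => normc (f x) ^+ 2).
Proof.
move=> [mr mi]; under eq_fun do rewrite normcK.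
by apply: measurable_funD; exact: measurable_funX.
Qed.

Lemma emeasurable_normc_sqr f : cmeasurable f ->
  measurable_fun setT (fun x => (normc (f x) ^+ 2)%:E).
Proof. by move=> mf; apply/measurable_EFinP; exact: measurable_normc_sqr. Qed.

Lemma cmeasurableB f g : cmeasurable f -> cmeasurable g ->
  cmeasurable (fun x => f x - g x).
Proof.
move=> [fr fi] [gr gi]; split.
- rewrite (_ : (fun _ => _) = (fun x => complex.Re (f x) - complex.Re (g x))).
    exact: measurable_funB.
  by apply/funext => x; case: (f x) (g x) => ? ? [].
- rewrite (_ : (fun _ => _) = (fun x => complex.Im (f x) - complex.Im (g x))).
    exact: measurable_funB.
  by apply/funext => x; case: (f x) (g x) => ? ? [].
Qed.

Lemma cmeasurableM f g : cmeasurable f -> cmeasurable g ->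
  cmeasurable (fun x => f x * g x).
Proof.
move=> [fr fi] [gr gi]; split.
- rewrite (_ : (fun _ => _) = (fun x => complex.Re (f x) * complex.Re (g x) -
      complex.Im (f x) * complex.Im (g x))).
    by apply: measurable_funB; apply: measurable_funM.
  by apply/funext => x; case: (f x) (g x) => ? ? [].
- rewrite (_ : (fun _ => _) = (fun x => complex.Re (f x) * complex.Im (g x) +
      complex.Im (f x) * complex.Re (g x))).
    by apply: measurable_funD; apply: measurable_funM.
  by apply/funext => x; case: (f x) (g x) => ? ? [].
Qed.

Lemma cmeasurable_real (f : T -> R) : measurable_fun setT f ->
  cmeasurable (fun x => (f x)%:C%C).
Proof. by move=> mf; split. Qed.

Lemma cmeasurable_comp (d' : measure_display) (T' : measurableType d')
    (f : T -> R[i]) (h : T' -> T) : cmeasurable f -> measurable_fun setT h ->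
  cmeasurable (f \o h).
Proof.
by move=> [fr fi] mh; split;
  [exact: (measurableT_comp fr)|exact: (measurableT_comp fi)].
Qed.

End cmeasurable_theory.

(** Inversion is continuous off 0, and a single point is measurable. *)
Lemma measurable_inv (R : realType) : measurable_fun [set: R] (@GRing.inv R).
Proof.
rewrite -(setvU [set 0 : R]); apply/measurable_funU => //.
  exact: measurableC.
split; last first.
  by move=> _ Y mY; exact: (measurable_fun_set1 (@GRing.inv R)).
apply: open_continuous_measurable_fun.
  exact/closed_openC.
by move=> x /set_mem /= /eqP x0; apply: inv_continuous.
Qed.

Lemma itv_sym (R : realType) (s : R) :
  [set t : R | `|t| <= s] = `[- s, s]%classic.
Proof. by apply/seteqP; split=> t /=; rewrite in_itv/= ler_norml. Qed.

Section L2.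
Context {R : realType}.
Notation leb := (@lebesgue_measure R).
Implicit Types x y : R -> R[i].

Lemma continuous_cmeasurable (f : R -> R[i]) :
  continuous (f : R -> R[i]^o) -> cmeasurable f.
Proof.
by move=> cf; split; apply: continuous_measurable_fun;
  [exact: continuous_Re|exact: continuous_Im].
Qed.

Lemma L2norm_sqr x : (L2norm x ^+ 2 = \int[leb]_t (normc (x t) ^+ 2)%:E)%E.
Proof.
have int0 : (0 <= \int[leb]_t (normc (x t) ^+ 2)%:E)%E.
  by apply: integral_ge0 => t _; rewrite lee_fin sqr_ge0.
rewrite /L2norm unlock.
rewrite [X in (X `^ _)%E](_ : _ = \int[leb]_t (normc (x t) ^+ 2)%:E)%E.
  by rewrite poweR12_sqrt// sqr_sqrte.
apply: eq_integral => t _ /=.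
by rewrite ger0_norm ?modulus_ge0// powR_mulrn ?modulus_ge0.
Qed.

Lemma L2norm_lty x :
  ((L2norm x < +oo) = (\int[leb]_t (normc (x t) ^+ 2)%:E < +oo))%E.
Proof.
rewrite -L2norm_sqr.
have : (0 <= L2norm x)%E by exact: Lnorm_ge0.
case: (L2norm x) => [r||]// _.
by rewrite -EFin_expe !ltry.
Qed.

Lemma L2P x :
  L2 x <-> cmeasurable x /\ (\int[leb]_t (normc (x t) ^+ 2)%:E < +oo)%E.
Proof. by rewrite -L2norm_lty. Qed.

End L2.

Lemma Re_mul_real (R : realType) (z : R[i]) (a : R) :
  complex.Re (z * a%:C%C) = complex.Re z * a.
Proof. by case: z => b c /=; rewrite mulr0 subr0. Qed.

Lemma Im_mul_real (R : realType) (z : R[i]) (a : R) :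
  complex.Im (z * a%:C%C) = complex.Im z * a.
Proof. by case: z => b c /=; rewrite mulr0 add0r. Qed.

Section L2_criteria.
Context {R : realType}.
Notation leb := (@lebesgue_measure R).

Lemma L2_bounded_support (f : R -> R[i]) (C s : R) : cmeasurable f ->
  (forall t, normc (f t) ^+ 2 <= C) -> (forall t, s < `|t| -> f t = 0) -> L2 f.
Proof.
move=> mf fC f0; apply/L2P; split=> //.
have C0 : 0 <= C by apply: le_trans (fC 0); rewrite sqr_ge0.
apply: (@le_lt_trans _ _ (\int[leb]_t (C%:E * (\1_(`[- s, s]) t)%:E))%E).
  apply: ge0_le_integral => //=.
  - by move=> t _; rewrite lee_fin sqr_ge0.
  - exact: emeasurable_normc_sqr.
  - by apply/measurable_EFinP; apply: measurable_funM => //; exact: measurable_indic.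
  move=> t _; rewrite -EFinM lee_fin indicE -itv_sym.
  have [ts|ts] := leP `|t| s; first by rewrite mem_set// mulr1.
  by rewrite f0// normcK /= expr0n addr0 mulr_ge0.
rewrite ge0_integralZl//; last first.
- by apply/measurable_EFinP; exact: measurable_indic.
rewrite integral_indic//= setIT lebesgue_measure_itv/=.
by case: ifP => _; rewrite ?mule0// -EFinM ltry.
Qed.

(** |x y| <= |x|^2 + |y|^2. *)
Lemma L2_mul_cintegrable (x y : R -> R[i]) : L2 x -> L2 y ->
  cintegrable leb (fun t => x t * y t).
Proof.
move=> /L2P[mx x2] /L2P[my y2].
have [mr mi] := cmeasurableM mx my.
have dom : leb.-integrable setT
    (fun t => (normc (x t) ^+ 2)%:E + (normc (y t) ^+ 2)%:E)%E.
  apply: integrableD => //; apply/integrableP; split;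
    do ?exact: emeasurable_normc_sqr;
    by under eq_integral do rewrite gee0_abs ?lee_fin ?sqr_ge0//.
have bound t : normc (x t * y t) <= `|normc (x t) ^+ 2 + normc (y t) ^+ 2|.
  rewrite normcM ger0_norm ?addr_ge0 ?sqr_ge0//.
  by have := modulus_ge0 (x t); have := modulus_ge0 (y t); nra.
split; apply: le_integrable dom => //=.
- exact/measurable_EFinP.
- by move=> t _; rewrite lee_fin; apply: le_trans (bound t); exact: normc_ge_absRe.
- exact/measurable_EFinP.
- by move=> t _; rewrite lee_fin; apply: le_trans (bound t); exact: normc_ge_absIm.
Qed.

End L2_criteria.

(** * Integrals of continuous functions over symmetric intervals *)

Section symmetric_integral.
Context {R : realType} (h : R -> R).
Hypothesis h_continuous : continuous h.
Notation leb := (@lebesgue_measure R).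
Notation sym_integral := (fun s : R => \int[leb]_(t in [set t | `|t| <= s]) h t).

Lemma measurable_sym (s : R) : measurable [set t : R | `|t| <= s].
Proof. by rewrite itv_sym. Qed.

Lemma integrable_itv_continuous (a b : R) :
  leb.-integrable `[a, b] (EFin \o h).
Proof.
apply: continuous_compact_integrable; first exact: segment_compact.
exact: continuous_subspaceT.
Qed.

Lemma integrable_sym (s : R) :
  leb.-integrable [set t | `|t| <= s] (EFin \o h).
Proof. by rewrite itv_sym; exact: integrable_itv_continuous. Qed.

(** The fundamental theorem of calculus makes this primitive differentiable. *)
Lemma primitive_continuous (M x : R) : `|x| < M ->
  {for x, continuous (fun u => \int[leb]_(t in `[- M, u]) h t)}.
Proof.
rewrite ltr_norml => /andP[Mx xM].
have hx : {for x, continuous h} by exact: h_continuous.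
have [df _] := continuous_FTC1_closed xM (integrable_itv_continuous _ _) Mx hx.
by apply: differentiable_continuous; apply/derivable1_diffP.
Qed.

(** Fixing the left endpoint at - M turns an integral with two moving endpoints
    into a difference of values of one primitive. *)
Lemma sym_integralE (M s : R) : 0 <= s -> s < M ->
  \int[leb]_(t in [set t | `|t| <= s]) h t =
  \int[leb]_(t in `[- M, s]) h t - \int[leb]_(t in `[- M, - s]) h t.
Proof.
move=> s0 sM; rewrite itv_sym -Rintegral_itv_obnd_cbnd; last first.
  apply: integrableS (integrable_itv_continuous (- s) s) => //.
  exact: subset_itv_oc_cc.
rewrite Rintegral_itvB//; first exact: integrable_itv_continuous.
- by rewrite bnd_simp lerN2 ltW.
- by rewrite bnd_simp; lra.
Qed.

Lemma sym_integral_continuous (s : R) :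
  0 < s -> {for s, continuous sym_integral}.
Proof.
move=> s0; pose M := s + 1.
pose g u := \int[leb]_(t in `[- M, u]) h t - \int[leb]_(t in `[- M, - u]) h t.
have sM : `|s| < M by rewrite gtr0_norm// /M; lra.
have g_cont : {for s, continuous g}.
  apply: continuousB; first exact: primitive_continuous.
  apply: (@continuous_comp _ _ _ (fun u : R => - u)
    (fun u => \int[leb]_(t in `[- M, u]) h t)).
    exact: opp_continuous.
  by apply: primitive_continuous; rewrite normrN.
have gs : g s = \int[leb]_(t in [set t | `|t| <= s]) h t.
  by rewrite /g -sym_integralE ?ltW// /M ltrDl.
change (\int[leb]_(t in [set t | `|t| <= u]) h t @[u --> s] -->
  \int[leb]_(t in [set t | `|t| <= s]) h t); rewrite -gs.
apply: cvg_trans g_cont; apply: near_eq_cvg; near=> u.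
rewrite /g -sym_integralE//.
- by apply: ltW; near: u; exact: lt_nbhsr.
- by near: u; apply: lt_nbhsl; rewrite /M ltrDl.
Unshelve. all: by end_near. Qed.

Lemma sym_integral_cvg0 : sym_integral s @[s --> 0^'+] --> 0.
Proof.
pose g u := \int[leb]_(t in `[- 1, u]) h t - \int[leb]_(t in `[- 1, - u]) h t.
have g0 : g 0 = 0 by rewrite /g oppr0 subrr.
have g_cont : {for 0, continuous g}.
  apply: continuousB; first by apply: primitive_continuous; rewrite normr0.
  apply: (@continuous_comp _ _ _ (fun u : R => - u)
    (fun u => \int[leb]_(t in `[- 1, u]) h t)).
    exact: opp_continuous.
  by apply: primitive_continuous; rewrite normrN normr0.
have : g u @[u --> 0^'+] --> 0.
  by apply: cvg_at_right_filter; rewrite -[X in _ --> X]g0.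
apply: cvg_trans; apply: near_eq_cvg; near=> u.
by rewrite /g -sym_integralE.
Unshelve. all: by end_near. Qed.

Lemma le_sym_integral (s s' : R) :
  s <= s' -> (forall t, `|t| <= s' -> 0 <= h t) ->
  sym_integral s <= sym_integral s'.
Proof.
move=> ss' h0.
have fin u : (\int[leb]_(x in [set t | `|t| <= u]%R) (h x)%:E \is a fin_num)%E.
  by apply: integrable_fin_num; [exact: measurable_sym|exact: integrable_sym].
apply: fine_le => //.
apply: ge0_subset_integral; do ?exact: measurable_sym.
- apply/measurable_EFinP; apply: measurable_funTS; exact: continuous_measurable_fun.
- by move=> t ts; rewrite lee_fin h0.
- by move=> t /= ts; exact: le_trans ss'.
Qed.

Lemma integral_sym_EFin (s : R) :
  (\int[leb]_(t in [set t | (`|t| <= s)%R]) (h t)%:E =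
   (\int[leb]_(t in [set t | (`|t| <= s)%R]) h t)%:E)%E.
Proof.
rewrite fineK//; apply: integrable_fin_num; first exact: measurable_sym.
exact: integrable_sym.
Qed.

End symmetric_integral.

Lemma integral_on_support (R : realType) (f g : R -> R) (s : R) :
  (forall t, `|t| <= s -> f t = g t) -> (forall t, s < `|t| -> f t = 0) ->
  (\int[lebesgue_measure]_t (f t)%:E =
   \int[lebesgue_measure]_(t in [set t | (`|t| <= s)%R]) (g t)%:E)%E.
Proof.
move=> fg f0; rewrite [RHS]integral_mkcond; apply: eq_integral => t _.
rewrite patchE; case: ifPn => [/set_mem/fg->//|].
by move/negP; rewrite inE /= => /negP; rewrite -ltNge => /f0 ->.
Qed.

Lemma continuous_scale (R : realType) (q : R) (h : R -> R) :
  continuous h -> continuous (fun t => q * h t).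
Proof.
by move=> ch t; apply: (@continuousM _ _ (fun=> q) h); [exact: cvg_cst|exact: ch].
Qed.

Lemma continuous_sub (R : realType) (f h : R -> R) :
  continuous f -> continuous h -> continuous (fun t => f t - h t).
Proof.
by move=> cf ch t; apply: (@continuousB _ _ _ f h); [exact: cf|exact: ch].
Qed.

(** * The quotient and the equation for the cutoff *)

Section profile.
Context {R : realType} (mu : R -> R[i]) (nu : R -> R).
Notation leb := (@lebesgue_measure R).
Hypothesis mu_continuous : continuous (mu : R -> R[i]^o).
Hypothesis nu_continuous : continuous nu.
Hypothesis nu_ge0 : forall t, 0 <= nu t.
Hypothesis mu_even : forall t, normc (mu (- t)) = normc (mu t).
Hypothesis nu_even : forall t, nu (- t) = nu t.
Hypothesis decreasing : quotient_decreasing mu nu.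

Lemma quotient_ge0 t : 0 <= quotient mu nu t.
Proof. by rewrite divr_ge0 ?modulus_ge0 ?sqrtr_ge0. Qed.

Lemma quotient_lt s t : 0 < s -> s < t -> quotient mu nu t < quotient mu nu s.
Proof.
move=> s0 st; apply: decreasing => [||s00] //; first exact: ltW.
by rewrite s00 ltxx in s0.
Qed.

(** The quotient lies strictly above its nonnegative later values; so neither
    mu nor nu vanishes away from the origin. *)
Lemma quotient_gt0 s : 0 < s -> 0 < quotient mu nu s.
Proof.
move=> s0; apply: le_lt_trans (quotient_ge0 (s + 1)) _.
by apply: quotient_lt => //; rewrite ltrDl.
Qed.

Lemma normc_mu_gt0 s : 0 < s -> 0 < normc (mu s).
Proof.
move=> /quotient_gt0 q0; rewrite lt_neqAle modulus_ge0 andbT.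
apply: contraTN q0; rewrite /quotient => /eqP <-; by rewrite mul0r ltxx.
Qed.

Lemma sqrt_nu_gt0 s : 0 < s -> 0 < Num.sqrt (nu s).
Proof.
move=> /quotient_gt0 q0; rewrite lt_neqAle sqrtr_ge0 andbT.
apply: contraTN q0; rewrite /quotient => /eqP <-; by rewrite invr0 mulr0 ltxx.
Qed.

Lemma quotient_even t : quotient mu nu `|t| = quotient mu nu t.
Proof.
by rewrite /quotient; case: (ger0P t) => // _; rewrite mu_even nu_even.
Qed.

Lemma nu_norm t : nu `|t| = nu t.
Proof. by case: (ger0P t). Qed.

(** Stated without dividing by sqrt nu, the comparison of quotients also holds
    at the origin when nu vanishes there. *)
Lemma quotient_sqrt_le s t : 0 < s -> `|t| <= s ->
  quotient mu nu s * Num.sqrt (nu t) <= normc (mu t).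
Proof.
move=> s0 ts; have [nut|nut] := eqVneq (Num.sqrt (nu t)) 0.
  by rewrite nut mulr0 modulus_ge0.
rewrite -ler_pdivlMr ?lt_neqAle 1?eq_sym ?nut ?sqrtr_ge0//.
rewrite -/(quotient mu nu t) -(quotient_even t).
move: ts; rewrite le_eqVlt => /predU1P[->//|ts].
apply/ltW/decreasing => // t0.
by apply: contraNN nut => /eqP nu0; rewrite -nu_norm t0 nu0 sqrtr0.
Qed.

Lemma quotient_sqrt_ge s t : 0 < s -> s <= `|t| ->
  normc (mu t) <= quotient mu nu s * Num.sqrt (nu t).
Proof.
move=> s0 st; have t0 := lt_le_trans s0 st.
rewrite -ler_pdivrMr; last by rewrite -nu_norm sqrt_nu_gt0.
rewrite -/(quotient mu nu t) -(quotient_even t).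
move: st; rewrite le_eqVlt => /predU1P[->//|st].
exact/ltW/quotient_lt.
Qed.

(** With this density the level function becomes
    (1 / quotient s) int cross - int nu, in which both integrands are
    continuous although |mu| / sqrt nu may blow up at 0. *)
Definition cross t := normc (mu t) * Num.sqrt (nu t).

Lemma cross_continuous : continuous cross.
Proof.
move=> t; apply: (@continuousM _ _ (fun t => normc (mu t))
  (fun t => Num.sqrt (nu t))); first exact: continuous_normc.
by apply: continuous_comp; [exact: nu_continuous|exact: sqrt_continuous].
Qed.

(** Where nu = 0 both sides vanish, whatever the value given to the
    quotient. *)
Lemma level_integrandE (q t : R) :
  (q * (normc (mu t) / Num.sqrt (nu t)) - 1) * nu t = q * cross t - nu t.
Proof.
rewrite mulrBl mul1r; congr (_ - _); rewrite /cross.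
have [nut|nut] := eqVneq (Num.sqrt (nu t)) 0.
  by rewrite nut invr0 !mulr0 mul0r.
by rewrite -[X in _ * X](sqr_sqrtr (nu_ge0 t)); field.
Qed.

Lemma levelE s : level mu nu s = \int[leb]_(t in [set t | `|t| <= s])
  ((quotient mu nu s)^-1 * cross t - nu t).
Proof. by apply: eq_Rintegral => t _; rewrite level_integrandE invf_div. Qed.

Lemma level_split (q s : R) :
  \int[leb]_(t in [set t | `|t| <= s]) (q * cross t - nu t) =
  q * (\int[leb]_(t in [set t | `|t| <= s]) cross t)
  - \int[leb]_(t in [set t | `|t| <= s]) nu t.
Proof.
have [iA iB] := (integrable_sym cross_continuous s, integrable_sym nu_continuous s).
rewrite RintegralB//; do ?exact: measurable_sym; last first.
  exact: integrable_sym (@continuous_scale _ q _ cross_continuous) s.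
by rewrite RintegralZl//; exact: measurable_sym.
Qed.

Lemma excess_continuous (q : R) : continuous (fun t => q * cross t - nu t).
Proof.
exact: (continuous_sub (@continuous_scale _ q _ cross_continuous) nu_continuous).
Qed.

Lemma excess_ge0 s t : 0 < s -> `|t| <= s ->
  0 <= (quotient mu nu s)^-1 * cross t - nu t.
Proof.
move=> s0 ts; rewrite subr_ge0 mulrC ler_pdivlMr ?quotient_gt0//.
rewrite -[X in X * _](sqr_sqrtr (nu_ge0 t)) /cross expr2 mulrAC mulrC.
by rewrite [leRHS]mulrC ler_wpM2l ?sqrtr_ge0// mulrC quotient_sqrt_le.
Qed.

(** If level s > 0 then int cross > 0 over [-s, s], so increasing 1 / quotient
    raises the level strictly; enlarging the interval then only adds a
    nonnegative excess. *)
Lemma level_increasing s s' : 0 < s -> s < s' -> 0 < level mu nu s ->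
  level mu nu s < level mu nu s'.
Proof.
move=> s0 ss' fs0; have s'0 := lt_trans s0 ss'.
set A := \int[leb]_(t in [set t | `|t| <= s]) cross t.
set B := \int[leb]_(t in [set t | `|t| <= s]) nu t.
have fsE : level mu nu s = (quotient mu nu s)^-1 * A - B.
  by rewrite levelE level_split.
have B0 : 0 <= B by exact: Rintegral_ge0.
have A0 : 0 < A.
  have : 0 < (quotient mu nu s)^-1 * A by move: fs0; rewrite fsE; lra.
  by rewrite pmulr_rgt0// invr_gt0 quotient_gt0.
apply: (@lt_le_trans _ _ ((quotient mu nu s')^-1 * A - B)).
  rewrite fsE ltrD2r ltr_pM2r// ltf_pV2 ?posrE ?quotient_gt0//.
  exact: quotient_lt.
rewrite /A /B -level_split levelE.
apply: (le_sym_integral (@excess_continuous _)); first exact: ltW.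
by move=> t; exact: excess_ge0.
Qed.

Lemma level_continuous s : 0 < s -> {for s, continuous (level mu nu)}.
Proof.
move=> s0.
rewrite (_ : level mu nu = fun s => Num.sqrt (nu s) / normc (mu s) *
    (\int[leb]_(t in [set t | `|t| <= s]) cross t) -
    \int[leb]_(t in [set t | `|t| <= s]) nu t); last first.
  by apply/funext => u; rewrite levelE level_split invf_div.
apply: continuousB; last exact: sym_integral_continuous.
apply: continuousM; last exact: (sym_integral_continuous cross_continuous).
apply: continuousM.
  by apply: continuous_comp; [exact: nu_continuous|exact: sqrt_continuous].
apply: continuousV; last exact: continuous_normc.
by rewrite gt_eqF// normc_mu_gt0.
Qed.

(** For s <= 1 the factor 1 / quotient s is at most 1 / quotient 1, while the
    integral of cross tends to 0. *)
Lemma level_small (e : R) : 0 < e -> exists2 s, 0 < s & level mu nu s < e.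
Proof.
move=> e0; have c0 : 0 < quotient mu nu 1 by exact: quotient_gt0.
have /cvgrPdist_lt/(_ (e * quotient mu nu 1)) := sym_integral_cvg0 cross_continuous.
move=> /(_ (mulr_gt0 e0 c0)) near_small.
have : \forall s \near 0^'+, [/\ 0 < s, s < 1 &
    `|0 - \int[leb]_(t in [set t | `|t| <= s]) cross t| < e * quotient mu nu 1].
  near=> s; split; near: s => //; [exact: nbhs_right_gt|exact: nbhs_right_lt].
move=> /filter_ex[s [s0 s1]]; rewrite sub0r normrN => small.
exists s => //; rewrite levelE level_split.
set A := \int[leb]_(t in _) cross t in small *.
have A0 : 0 <= A.
  by apply: Rintegral_ge0 => t _; rewrite mulr_ge0 ?modulus_ge0 ?sqrtr_ge0.
have B0 : 0 <= \int[leb]_(t in [set t | `|t| <= s]) nu t by exact: Rintegral_ge0.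
apply: (@le_lt_trans _ _ (A / quotient mu nu 1)); last first.
  by rewrite ltr_pdivrMr// -(ger0_norm A0).
rewrite lerBlDr [leLHS]mulrC; apply: ler_wpDr => //.
rewrite ler_wpM2l// lef_pV2 ?posrE ?quotient_gt0//.
exact/ltW/quotient_lt.
Unshelve. all: by end_near. Qed.

Hypothesis level_infty : level mu nu s @[s --> +oo%R] --> +oo%R.

(** The intermediate value theorem gives a root; monotonicity at positive levels
    makes it unique, as v > 0. *)
Lemma level_root (v : R) : 0 < v -> exists s,
  [/\ 0 < s, level mu nu s = v & forall u, 0 < u -> level mu nu u = v -> u = s].
Proof.
move=> v0; have [a a0 fa] := level_small v0.
have : \forall s \near +oo, a < s /\ v <= level mu nu s.
  near=> s; split; near: s.
    by apply: nbhs_pinfty_gt; exact: num_real.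
  by move/cvgryPge : level_infty; apply.
move=> /filter_ex[b [ab fb]].
have cont : {within `[a, b], continuous (level mu nu)}.
  apply: continuous_in_subspaceT => s; rewrite inE/= in_itv/= => /andP[as_ _].
  exact/level_continuous/(lt_le_trans a0).
have [|s] := IVT (ltW ab) cont (v := v).
  by rewrite ge_min (ltW fa)/= le_max fb orbT.
rewrite in_itv/= => /andP[as_ _] fs; have s0 := lt_le_trans a0 as_.
exists s; split=> // u u0 fu; have [us|su|//] := ltgtP u s.
- by have := level_increasing u0 us; rewrite fu fs ltxx => /(_ v0).
- by have := level_increasing s0 su; rewrite fu fs ltxx => /(_ v0).
Unshelve. all: by end_near. Qed.

End profile.

(** * The risk of the shrinkage method *)

Section bias_variance.
Context {R : realType} {d : measure_display} {T : measurableType d}.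
Variables (P : probability T R) (X : T -> R[i]).

(** m z - a m X = m ((1 - a) z - a (X - z)), and the cross term has mean 0. *)
Lemma bias_variance (a delta : R) (m z : R[i]) :
  cintegrable P X -> cexpectation P X = z ->
  (cvariance P X <= (delta ^+ 2)%:E)%E ->
  (\int[P]_w (normc (m * z - a%:C%C * m * X w) ^+ 2)%:E <=
   (normc m ^+ 2 * ((1 - a) ^+ 2 * normc z ^+ 2 + a ^+ 2 * delta ^+ 2))%:E)%E.
Proof.
move=> [iRe iIm] EX; rewrite /cvariance EX => VX.
have mRe : measurable_fun setT (fun w => complex.Re (X w)).
  by apply/measurable_EFinP; exact: measurable_int iRe.
have mIm : measurable_fun setT (fun w => complex.Im (X w)).
  by apply/measurable_EFinP; exact: measurable_int iIm.
have ERe : (\int[P]_w (complex.Re (X w))%:E = (complex.Re z)%:E)%E.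
  by rewrite -EX /= fineK// integrable_fin_num.
have EIm : (\int[P]_w (complex.Im (X w))%:E = (complex.Im z)%:E)%E.
  by rewrite -EX /= fineK// integrable_fin_num.
have mV : measurable_fun setT (fun w => (normc (X w - z) ^+ 2)%:E).
  by apply/emeasurable_normc_sqr/cmeasurableB; split.
have iV : P.-integrable setT (fun w => (normc (X w - z) ^+ 2)%:E).
  apply/integrableP; split=> //.
  under eq_integral do rewrite gee0_abs ?lee_fin ?sqr_ge0//.
  exact: le_lt_trans VX (ltry _).
pose K := normc m ^+ 2.
pose b := - (2 * K * a * (1 - a)).
pose c0 := K * ((1 - a) ^+ 2 + 2 * a * (1 - a)) * normc z ^+ 2.
(* The mean of X - z is used through Re X and Im X separately: the constant c0
   collects what the cross term leaves at z. *)
have decomposition w : (normc (m * z - a%:C%C * m * X w) ^+ 2)%:E =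
  (c0%:E + ((b * complex.Re z)%:E * (complex.Re (X w))%:E +
    ((b * complex.Im z)%:E * (complex.Im (X w))%:E +
     (K * a ^+ 2)%:E * (normc (X w - z) ^+ 2)%:E)))%E.
  rewrite -!EFinM -!EFinD; congr EFin.
  rewrite (_ : m * z - _ = m * (z - a%:C%C * X w)); last by ring.
  rewrite normcM exprMn /b /c0 /K.
  case: (X w) z {EX VX ERe EIm mV iV c0} => x y [u v].
  by rewrite !normcK /=; ring.
under eq_integral do rewrite decomposition.
have ic : P.-integrable setT (cst c0%:E) by exact: finite_measure_integrable_cst.
have i1 := integrableZl measurableT (b * complex.Re z) iRe.
have i2 := integrableZl measurableT (b * complex.Im z) iIm.
have i3 := integrableZl measurableT (K * a ^+ 2) iV.
have i23 := integrableD measurableT i2 i3.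
rewrite integralD//; last exact: integrableD.
rewrite integralD// integralD//.
rewrite !integralZl// ERe EIm integral_cst//.
rewrite [X in (_ * X)%E](_ : _ = 1%E) ?mule1; last exact: probability_setT.
have : ((K * a ^+ 2)%:E * \int[P]_w (normc (X w - z) ^+ 2)%:E <=
        (K * a ^+ 2 * delta ^+ 2)%:E)%E.
  by rewrite [leRHS]EFinM lee_wpmul2l// lee_fin mulr_ge0 ?sqr_ge0.
move=> KV; rewrite -!EFinM.
apply: (@le_trans _ _ (c0%:E + ((b * complex.Re z * complex.Re z)%:E +
  ((b * complex.Im z * complex.Im z)%:E + (K * a ^+ 2 * delta ^+ 2)%:E)))%E).
  by rewrite !leeD2l.
rewrite -!EFinD lee_fin le_eqVlt; apply/orP; left; apply/eqP.
by rewrite /c0 /b /K (normcK z); ring.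
Qed.

End bias_variance.

Section shrinkage.
Context {R : realType} (mu : R -> R[i]) (nu : R -> R) (s : R).
Notation leb := (@lebesgue_measure R).
Hypothesis mu_continuous : continuous (mu : R -> R[i]^o).
Hypothesis nu_continuous : continuous nu.
Hypothesis nu_ge0 : forall t, 0 <= nu t.
Hypothesis mu_even : forall t, normc (mu (- t)) = normc (mu t).
Hypothesis nu_even : forall t, nu (- t) = nu t.
Hypothesis decreasing : quotient_decreasing mu nu.
Hypothesis s_gt0 : 0 < s.
Notation c := (quotient mu nu s).

Definition damping (t : R) : R :=
  1 - Num.sqrt (nu t) / normc (mu t) * quotient mu nu s.

Definition weight (t : R) : R := Num.max (damping t) 0.

Definition shrink (y : R -> R[i]) (t : R) : R[i] := (weight t)%:C%C * mu t * y t.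

(** The modulus of the multiplier weight * mu, written without the division by
    |mu|. *)
Definition gain (t : R) : R := Num.max (normc (mu t) - c * Num.sqrt (nu t)) 0.

Lemma mul_damping t : damping t * normc (mu t) = 
  if normc (mu t) == 0 then 0 else normc (mu t) - c * Num.sqrt (nu t).
Proof.
case: eqVneq => [->|mt]; first by rewrite mulr0.
by rewrite /damping; move: (quotient _ _ _) => q; field.
Qed.

Lemma weight_mul t : weight t * normc (mu t) = gain t.
Proof.
rewrite /weight maxr_pMl ?modulus_ge0// mul0r mul_damping /gain.
have cs : 0 <= c * Num.sqrt (nu t) by rewrite mulr_ge0 ?quotient_ge0 ?sqrtr_ge0.
case: eqVneq => [->|//]; rewrite sub0r !max_r ?oppr_le0//.
Qed.

Lemma bias_le t : 0 <= normc (mu t) - gain t <= c * Num.sqrt (nu t).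
Proof.
have cs : 0 <= c * Num.sqrt (nu t) by rewrite mulr_ge0 ?quotient_ge0 ?sqrtr_ge0.
have m0 := modulus_ge0 (mu t).
rewrite /gain; case: (leP (normc (mu t) - c * Num.sqrt (nu t)) 0) => h;
  by apply/andP; split; lra.
Qed.

Lemma gain_ge0 t : 0 <= gain t. Proof. by rewrite le_max lexx orbT. Qed.

Lemma gain_support t : s < `|t| -> gain t = 0.
Proof.
by move=> st; rewrite /gain max_r// subr_le0 quotient_sqrt_ge// ltW.
Qed.

Lemma gain_inside t : `|t| <= s -> gain t = normc (mu t) - c * Num.sqrt (nu t).
Proof. by move=> ts; rewrite /gain max_l// subr_ge0 quotient_sqrt_le. Qed.

Lemma measurable_sqrt_nu : measurable_fun setT (fun t => Num.sqrt (nu t)).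
Proof.
apply: continuous_measurable_fun => t.
by apply: continuous_comp; [exact: nu_continuous|exact: sqrt_continuous].
Qed.

Lemma measurable_modulus : measurable_fun setT (fun t => normc (mu t)).
Proof. by apply: continuous_measurable_fun; exact: continuous_normc. Qed.

Lemma measurable_damping : measurable_fun setT damping.
Proof.
apply: measurable_funB => //; apply: measurable_funM => //.
apply: measurable_funM; first exact: measurable_sqrt_nu.
exact: (measurableT_comp (@measurable_inv R) measurable_modulus).
Qed.

Lemma measurable_weight : measurable_fun setT weight.
Proof. by apply: measurable_maxr => //; exact: measurable_damping. Qed.

Lemma measurable_gain : measurable_fun setT gain.
Proof.
rewrite (_ : gain = fun t => weight t * normc (mu t)); last first.
  by apply/funext => t; rewrite weight_mul.
by apply: measurable_funM; [exact: measurable_weight|exact: measurable_modulus].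
Qed.

Lemma cmeasurable_weight_mu : cmeasurable (fun t => (weight t)%:C%C * mu t).
Proof.
apply: cmeasurableM; first by apply: cmeasurable_real; exact: measurable_weight.
exact: continuous_cmeasurable.
Qed.

Lemma normc_weight_mu t : normc ((weight t)%:C%C * mu t) = gain t.
Proof.
by rewrite normcM modulus_real ger0_norm ?weight_mul// le_max lexx orbT.
Qed.

(** The gain is at most |mu|, which is bounded on [-s, s], and vanishes
    outside. *)
Lemma gain_bounded : exists2 C : R, 0 <= C & forall t, gain t <= C.
Proof.
have cont : {within `[- s, s], continuous (fun t => normc (mu t))}.
  by apply: continuous_subspaceT; exact: continuous_normc.
have ss : - s <= s by move: s_gt0 => s0; lra.
have [u _ ub] := EVT_max ss cont.
exists (normc (mu u)); first exact: modulus_ge0.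
move=> t; have [ts|st] := leP `|t| s; last by rewrite gain_support// modulus_ge0.
rewrite gain_inside//; apply: (@le_trans _ _ (normc (mu t))).
  by rewrite gerBl mulr_ge0 ?quotient_ge0 ?sqrtr_ge0.
by apply: ub; rewrite in_itv/= -ler_norml.
Qed.

Lemma shrink_recovery : recovery_method shrink.
Proof.
split=> [x /L2P[mx x2]|x x' _ _]; last first.
  by apply: filterS => t xx' _; rewrite /shrink xx'.
have mphi : cmeasurable (shrink x).
  by apply: cmeasurableM => //; exact: cmeasurable_weight_mu.
apply/L2P; split=> //.
have [C C0 gC] := gain_bounded.
apply: (@le_lt_trans _ _ (\int[leb]_t ((C ^+ 2)%:E * (normc (x t) ^+ 2)%:E))%E).
  apply: ge0_le_integral => //.
  - by move=> t _; rewrite lee_fin sqr_ge0.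
  - exact: emeasurable_normc_sqr.
  - by apply: emeasurable_funM => //; exact: emeasurable_normc_sqr.
  move=> t _; rewrite -EFinM lee_fin /shrink normcM normc_weight_mu exprMn.
  by rewrite ler_wpM2r ?sqr_ge0// ler_sqr ?nnegrE ?gain_ge0.
have mx2 := emeasurable_normc_sqr mx.
have x20 t : [set: R] t -> (0 <= (normc (x t) ^+ 2)%:E)%E by rewrite lee_fin sqr_ge0.
rewrite ge0_integralZl ?lee_fin ?sqr_ge0//.
by rewrite lte_mul_pinfty ?lee_fin ?sqr_ge0.
Qed.

Definition optimal_value : R := \int[leb]_(t in [set t | `|t| <= s])
  (normc (mu t) ^+ 2 - c * cross mu nu t).

Lemma modulus_sqr_continuous : continuous (fun t => normc (mu t) ^+ 2).
Proof.
by move=> t; apply: (@continuousM _ _ (fun t => normc (mu t)));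
  exact: continuous_normc.
Qed.

(** On [-s, s], gain^2 = |mu|^2 - c cross - c^2 (cross / c - nu), and the
    integral of cross / c - nu is level s = 1 / delta^2: the noise term absorbs
    the bias bound c^2. *)
Lemma shrink_risk_balance (delta : R) : 0 < delta -> level mu nu s = delta ^- 2 ->
  ((c ^+ 2)%:E + (delta ^+ 2)%:E * \int[leb]_t (gain t ^+ 2)%:E =
   (delta ^+ 2 * optimal_value)%:E)%E.
Proof.
move=> d0 fs; have c0 : 0 < c by exact: quotient_gt0.
have cC := cross_continuous mu_continuous nu_continuous.
rewrite (@integral_on_support _ _
  (fun t => (normc (mu t) ^+ 2 - c * cross mu nu t) -
  c ^+ 2 * (c^-1 * cross mu nu t - nu t)) s); last 2 first.
- move=> t ts; rewrite gain_inside// /cross sqrrB exprMn sqr_sqrtr//.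
  by field; rewrite gt_eqF.
- by move=> t /gain_support ->; rewrite expr0n.
have fin : (\int[leb]_(t in [set t | (`|t| <= s)%R])
  ((normc (mu t) ^+ 2 - c * cross mu nu t) -
  c ^+ 2 * (c^-1 * cross mu nu t - nu t))%:E =
  (optimal_value - c ^+ 2 * level mu nu s)%:E)%E.
  have c1 := continuous_sub modulus_sqr_continuous (@continuous_scale _ c _ cC).
  have i1 := integrable_sym c1 s.
  have cE := @excess_continuous _ _ _ mu_continuous nu_continuous c^-1.
  have i2 := integrable_sym cE s.
  have i3 := integrable_sym (@continuous_scale _ (c ^+ 2) _ cE) s.
  rewrite levelE// /optimal_value -RintegralZl//; last exact: measurable_sym.
  rewrite -RintegralB//; last exact: measurable_sym.
  rewrite fineK//; apply: integrable_fin_num; first exact: measurable_sym.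
  exact: (integrable_sym (continuous_sub c1 (@continuous_scale _ (c ^+ 2) _ cE)) s).
rewrite fin fs -EFinM -EFinD; congr EFin; field.
by rewrite gt_eqF.
Qed.

(** Tonelli moves the expectation inside, where [bias_variance] applies at
    almost every t; the bias is then controlled by the energy of x. *)
Lemma shrink_error (delta : R) : 0 < delta -> level mu nu s = delta ^- 2 ->
  (ereal_sup (mean_square_errors mu nu delta shrink) <=
   (delta ^+ 2 * optimal_value)%:E)%E.
Proof.
move=> d0 fs; apply: ge_ereal_sup => r /= [x [[[/L2P[mx x2] _] energy]]].
move=> [d [T [P [y [obs ->]]]]]; case: obs => my yL2 y_moments _ _.
have mmu := continuous_cmeasurable mu_continuous.
pose D (z : T * R) :=
  normc (mu z.2 * x z.2 - (weight z.2)%:C%C * mu z.2 * y z.1 z.2) ^+ 2.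
have mD : measurable_fun setT (EFin \o D).
  apply: emeasurable_normc_sqr; apply: cmeasurableB.
    exact: (cmeasurable_comp (cmeasurableM mmu mx) measurable_snd).
  apply: cmeasurableM => //.
  exact: (cmeasurable_comp cmeasurable_weight_mu measurable_snd).
have D0 z : (0 <= (EFin \o D) z)%E by rewrite lee_fin sqr_ge0.
under eq_integral do rewrite L2norm_sqr.
rewrite [leLHS](@fubini_tonelli _ _ _ _ _ P leb (EFin \o D) mD D0).
rewrite -shrink_risk_balance//.
have mx2 := emeasurable_normc_sqr mx.
have mnu : measurable_fun setT nu by exact: continuous_measurable_fun.
have mE1 : measurable_fun setT (fun t => (nu t * normc (x t) ^+ 2)%:E).
  by apply/measurable_EFinP; apply: measurable_funM => //; exact: measurable_normc_sqr.
have mE2 : measurable_fun setT (fun t => (gain t ^+ 2)%:E).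
  by apply/measurable_EFinP; apply: measurable_funX; exact: measurable_gain.
apply: (@le_trans _ _ (\int[leb]_t ((c ^+ 2)%:E * (nu t * normc (x t) ^+ 2)%:E +
   (delta ^+ 2)%:E * (gain t ^+ 2)%:E))%E).
  apply: ae_ge0_le_integral => //.
  - by move=> t _; exact: integral_ge0.
  - exact: (measurable_fun_fubini_tonelli_G (EFin \o D)).
  - by move=> t _; rewrite -!EFinM -EFinD lee_fin; apply: addr_ge0;
      apply: mulr_ge0; rewrite ?sqr_ge0// mulr_ge0 ?sqr_ge0.
  - by apply: emeasurable_funD; apply: emeasurable_funM.
  move: y_moments; apply: (filterS (Filter := ae_filter_ringOfSetsType _)).
  move=> t [iy Ey Vy] _.
  apply: le_trans (bias_variance (weight t) (mu t) iy Ey Vy) _.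
  rewrite -!EFinM -EFinD lee_fin mulrDr lerD//.
    rewrite mulrA -exprMn mulrBr mulr1 [X in _ - X]mulrC weight_mul.
    have /andP[b0 b1] := bias_le t.
    rewrite [leRHS]mulrA ler_wpM2r ?sqr_ge0//.
    rewrite -[X in _ * X](sqr_sqrtr (nu_ge0 t)) -exprMn.
    by rewrite ler_sqr ?nnegrE// (le_trans b0).
  by rewrite mulrA -exprMn [X in X ^+ 2]mulrC weight_mul mulrC.
have nux0 t : [set: R] t -> (0 <= (nu t * normc (x t) ^+ 2)%:E)%E.
  by rewrite lee_fin mulr_ge0 ?sqr_ge0.
have gain0 t : [set: R] t -> (0 <= (gain t ^+ 2)%:E)%E by rewrite lee_fin sqr_ge0.
rewrite ge0_integralD//; last 4 first.
- by move=> t _; rewrite mule_ge0 ?nux0 ?lee_fin ?sqr_ge0.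
- by apply: emeasurable_funM.
- by move=> t _; rewrite mule_ge0 ?gain0 ?lee_fin ?sqr_ge0.
- by apply: emeasurable_funM.
rewrite !ge0_integralZl ?lee_fin ?sqr_ge0//.
by rewrite leeD2r// -[leRHS]mule1 lee_wpmul2l ?lee_fin ?sqr_ge0.
Qed.

End shrinkage.

(** * Hidden random signs *)

Section uniform_draw.
Context {R : realType} (n : nat).

Lemma invS_ge0 : 0 <= n.+1%:R^-1 :> R. Proof. by rewrite invr_ge0. Qed.

(** The uniform distribution on {0, ..., n}.  It lives on nat because every
    function on nat is measurable, so the errors of an arbitrary recovery method
    can be averaged. *)
Definition draw : set nat -> \bar R :=
  mscale (NngNum invS_ge0)
    (msum (fun i : nat => dirac i : {measure set nat -> \bar R}) n.+1).

HB.instance Definition _ := Measure.on draw.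

Lemma ge0_integral_draw (f : nat -> \bar R) : (forall i, 0 <= f i)%E ->
  (\int[draw]_i f i = n.+1%:R^-1%:E * \sum_(i < n.+1) f i)%E.
Proof.
move=> f0; rewrite ge0_integral_mscale//= ge0_integral_measure_sum//.
congr (_ * _)%E; apply: eq_bigr => i _.
by rewrite integral_dirac// diracE mem_set// mul1e.
Qed.

Lemma draw_setT : draw setT = 1%E.
Proof.
rewrite -[LHS]mul1e -integral_cst// ge0_integral_draw//.
rewrite sumEFin -EFinM; congr EFin.
by rewrite sumr_const card_ord mulrC divff.
Qed.

HB.instance Definition _ := Measure_isProbability.Build _ _ R draw draw_setT.

Lemma integrable_draw (f : nat -> R) : draw.-integrable setT (EFin \o f).
Proof.
apply/integrableP; split=> //.
rewrite ge0_integral_draw//= sumEFin -EFinM; exact: ltry.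
Qed.

Lemma Rintegral_draw (f : nat -> R) :
  \int[draw]_i f i = n.+1%:R^-1 * \sum_(i < n.+1) f i.
Proof.
rewrite /Rintegral integralE !ge0_integral_draw//.
rewrite (eq_bigr (fun i : 'I__ => (Num.max (f i) 0)%:E)); last first.
  by move=> i _; rewrite funeposE EFin_max.
rewrite [in X in (_ - X)%E](eq_bigr
    (fun i : 'I__ => (Num.max (- f i) 0)%:E)); last first.
  by move=> i _; rewrite funenegE EFin_max.
rewrite !sumEFin -!EFinM -EFinB /= -mulrBr -sumrB; congr (_ * _).
apply: eq_bigr => i _; case: (leP 0 (f i)) => fi.
  by rewrite (max_idPr _) ?oppr_le0// subr0.
by rewrite (max_idPl _) ?oppr_ge0 ?ltW// sub0r opprK.
Qed.

Lemma draw_Rintegral_exchange (f : nat -> R -> R) :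
  (forall w, lebesgue_measure.-integrable setT (EFin \o f w)) ->
  \int[draw]_w \int[lebesgue_measure]_t f w t =
  \int[lebesgue_measure]_t \int[draw]_w f w t.
Proof.
move=> fi; under [RHS]eq_Rintegral do rewrite Rintegral_draw.
rewrite Rintegral_draw RintegralZl//; last first.
  under [X in integrable _ _ X]funext do rewrite /= -sumEFin.
  by apply: (integrable_sum measurableT) => i _; exact: fi.
congr (_ * _); rewrite /Rintegral; under [in RHS]eq_integral do rewrite -sumEFin.
rewrite (integral_sum measurableT); last by move=> i; exact: fi.
by rewrite sum_fine// => i _; apply: (integrable_fin_num measurableT); exact: fi.
Qed.

End uniform_draw.

Section random_signs.
Context {R : realType} (n : nat) (delta : R) (k : R -> nat).
Hypothesis k_measurable : measurable_fun setT k.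
Hypothesis k_lt : forall t, (k t < n.+1)%N.

(** If a value of modulus r is shown with probability p = j / (n + 1), rescaled
    by 1 / p, and replaced by 0 otherwise, the variance is r^2 (1 - p) / p; for
    j > 0 this r makes it equal to delta^2. *)
Definition amplitude (j : nat) : R := delta * Num.sqrt (j%:R / (n.+1 - j)%:R).

(** The sign depends on t only through k t, so that there are finitely many sign
    patterns.  As inord is injective on values below n + 1, distinct values of k
    carry distinct signs. *)
Definition signal (e : {ffun 'I_n.+1 -> bool}) (t : R) : R :=
  (-1) ^+ e (inord (k t)) * amplitude (k t).

(** All points share the draw w: those with w < k t are shown, the others are
    read as 0. *)
Definition reading (e : {ffun 'I_n.+1 -> bool}) (w : nat) (t : R) : R :=
  if (w < k t)%N then n.+1%:R / (k t)%:R * signal e t else 0.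

Lemma signal_sqr e t :
  signal e t ^+ 2 = delta ^+ 2 * ((k t)%:R / (n.+1 - k t)%:R).
Proof. by rewrite !exprMn sqrr_sign mul1r sqr_sqrtr// divr_ge0. Qed.

Lemma sum_threshold (j : nat) (a b : R) : (j <= n.+1)%N ->
  \sum_(w < n.+1) (if (w < j)%N then a else b) = a * j%:R + b * (n.+1 - j)%:R.
Proof.
move=> jn; rewrite -(big_mkord xpredT (fun w => if (w < j)%N then a else b)).
rewrite (@big_cat_nat _ _ _ j)//=; congr (_ + _).
- rewrite big_nat (eq_bigr (fun=> a)); last by move=> i /andP[_ ->].
  by rewrite -big_nat sumr_const_nat subn0 mulr_natr.
- rewrite big_nat (eq_bigr (fun=> b)); last first.
    by move=> i /andP[ji _]; rewrite ltnNge ji.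
  by rewrite -big_nat sumr_const_nat mulr_natr.
Qed.

Lemma reading_unbiased e t :
  n.+1%:R^-1 * \sum_(w < n.+1) reading e w t = signal e t.
Proof.
rewrite /reading sum_threshold ?(ltnW (k_lt t))// mul0r addr0.
have [k0|k0] := eqVneq (k t) 0%N; last first.
  by field; rewrite -(natrD _ 1) !pnatr_eq0 k0.
by rewrite /signal k0 /amplitude mul0r sqrtr0 !mulr0.
Qed.

Lemma reading_variance e t :
  n.+1%:R^-1 * \sum_(w < n.+1) (reading e w t - signal e t) ^+ 2 <= delta ^+ 2.
Proof.
rewrite (eq_bigr (fun w : 'I__ => if (w < k t)%N
  then (n.+1%:R / (k t)%:R - 1) ^+ 2 * signal e t ^+ 2
  else signal e t ^+ 2)); last first.
  move=> w _; rewrite /reading; case: ifP => _; last by rewrite sub0r sqrrN.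
  by rewrite -exprMn mulrBl mul1r.
rewrite sum_threshold ?(ltnW (k_lt t))// signal_sqr.
have [->|k0] := eqVneq (k t) 0%N.
  by rewrite !mul0r !mulr0 mul0r addr0 mulr0 sqr_ge0.
have m0 : (n.+1 - k t)%:R != 0 :> R by rewrite pnatr_eq0 subn_eq0 -ltnNge.
have kR0 : (k t)%:R != 0 :> R by rewrite pnatr_eq0.
have -> : n.+1%:R = (n.+1 - k t)%:R + (k t)%:R :> R.
  by rewrite -natrD subnK// ltnW.
rewrite [leLHS](_ : _ = delta ^+ 2)//; field.
by rewrite m0 kR0 /= -natrD subnK ?pnatr_eq0// ltnW.
Qed.

Lemma measurable_signal e : measurable_fun setT (signal e).
Proof.
exact: (@measurableT_comp _ _ _ _ _ _
  (fun j : nat => (-1) ^+ e (inord j) * amplitude j : R)).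
Qed.

Lemma measurable_reading e :
  measurable_fun setT (fun z : nat * R => reading e z.1 z.2).
Proof.
apply: measurable_fun_ifT => //.
- apply: measurable_fun_ltn => //; exact: measurableT_comp.
- apply: (@measurableT_comp _ _ _ _ _ _
   (fun j : nat => n.+1%:R / j%:R * ((-1) ^+ e (inord j) * amplitude j) : R)
     _ (k \o snd)) => //.
  exact: measurableT_comp.
Qed.

Lemma measurable_reading_at e w : measurable_fun setT (reading e w).
Proof. exact: (measurableT_comp (measurable_reading e) (pair1_measurable w)). Qed.

Definition flip_sign (i : 'I_n.+1) (e : {ffun 'I_n.+1 -> bool}) :=
  [ffun j => if j == i then ~~ e j else e j].

Lemma flip_signK i : involutive (flip_sign i).
Proof.
by move=> e; apply/ffunP => j; rewrite !ffunE; case: eqP => // _; rewrite negbK.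
Qed.

Lemma signal_flip e t : signal (flip_sign (inord (k t)) e) t = - signal e t.
Proof. by rewrite /signal ffunE eqxx signrN mulNr. Qed.

(** A sign that the draw w hides does not enter the observation at all. *)
Lemma reading_flip e t w : (k t <= w)%N ->
  reading (flip_sign (inord (k t)) e) w = reading e w.
Proof.
move=> kw; apply/funext => t'; rewrite /reading; case: ifP => // wk.
congr (_ * _); rewrite /signal ffunE ifN//; apply/eqP => /(congr1 (@nat_of_ord _)).
by rewrite !inordK// => kE; move: (leq_trans wk (eq_leq kE)); rewrite ltnNge kw.
Qed.

(** Pair each sign pattern with the one that differs in the hidden sign at t:
    the method receives the same observation for both, so by the parallelogram
    law the two errors add up to at least 2 |m|^2 signal^2. *)
Lemma hidden_sign_error (phi : (R -> R[i]) -> R -> R[i]) (m : R[i]) w t :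
  (k t <= w)%N ->
  \sum_e normc (m * (signal e t)%:C%C - phi (fun s => (reading e w s)%:C%C) t) ^+ 2
  >= \sum_(e : {ffun 'I_n.+1 -> bool})
       normc m ^+ 2 * (delta ^+ 2 * ((k t)%:R / (n.+1 - k t)%:R)).
Proof.
move=> kw; set F := fun e => normc (m * (signal e t)%:C%C -
  phi (fun s => (reading e w s)%:C%C) t) ^+ 2.
rewrite -[leRHS]/(\sum_e F e) -(@ler_pM2l _ 2)// mulr_sumr.
have -> : 2 * \sum_e F e = \sum_e (F e + F (flip_sign (inord (k t)) e)).
  rewrite big_split/= mulrDl mul1r; congr (_ + _).
  by rewrite (reindex_inj (inv_inj (flip_signK (inord (k t))))).
apply: ler_sum => e _; rewrite /F signal_flip reading_flip//.
rewrite rmorphN mulrN -(normcN (- _ - _)) opprB opprK [X in _ + normc X ^+ 2]addrC.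
rewrite [leRHS]addrC parallelogram ler_pM2l// normcM modulus_real exprMn.
by rewrite real_normK ?num_real// signal_sqr lerDl sqr_ge0.
Qed.

End random_signs.

Section lower_bound.
Context {R : realType} (n : nat) (delta : R) (k : R -> nat) (s : R).
Notation leb := (@lebesgue_measure R).
Hypothesis k_measurable : measurable_fun setT k.
Hypothesis k_lt : forall t, (k t < n.+1)%N.
Hypothesis k_support : forall t, s < `|t| -> k t = 0%N.
Implicit Types e : {ffun 'I_n.+1 -> bool}.

Notation signal := (signal delta k).
Notation reading := (reading delta k).

Lemma signal_sqr_le e t : signal e t ^+ 2 <= delta ^+ 2 * n.+1%:R.
Proof.
rewrite signal_sqr ler_wpM2l ?sqr_ge0//.
have nk : (0 < n.+1 - k t)%N by rewrite subn_gt0.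
rewrite ler_pdivrMr ?ltr0n// -natrM ler_nat.
by apply: leq_trans (ltnW (k_lt t)) _; rewrite leq_pmulr.
Qed.

Lemma signal_support e t : s < `|t| -> signal e t = 0.
Proof.
by move=> /k_support kt; rewrite /signal kt /amplitude mul0r sqrtr0 !mulr0.
Qed.

Lemma L2_signal e : L2 (fun t => (signal e t)%:C%C).
Proof.
apply: (@L2_bounded_support _ _ (delta ^+ 2 * n.+1%:R) s).
- apply: cmeasurable_real; exact: measurable_signal.
- by move=> t; rewrite modulus_real real_normK ?num_real// signal_sqr_le.
- by move=> t st; rewrite signal_support.
Qed.

Lemma L2_reading e w : L2 (fun t => (reading e w t)%:C%C).
Proof.
apply: (@L2_bounded_support _ _ (n.+1%:R ^+ 2 * (delta ^+ 2 * n.+1%:R)) s).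
- apply: cmeasurable_real; exact: measurable_reading_at.
- move=> t; rewrite modulus_real real_normK ?num_real// /reading.
  case: ifP => wk; last by rewrite expr0n mulr_ge0 ?sqr_ge0// mulr_ge0 ?sqr_ge0.
  rewrite exprMn ler_pM ?sqr_ge0 ?signal_sqr_le//.
  have k0 : (0 < k t)%N by apply: leq_ltn_trans wk.
  rewrite ler_sqr ?nnegrE ?divr_ge0// ler_pdivrMr ?ltr0n//.
  by rewrite ler_peMr// ler1n.
- by move=> t st; rewrite /reading k_support.
Qed.

Lemma cexpectation_reading e t :
  cexpectation (draw n) (fun w => (reading e w t)%:C%C) = (signal e t)%:C%C.
Proof.
rewrite /cexpectation /cintegral /= !Rintegral_draw reading_unbiased//.
by rewrite big1// mulr0.
Qed.

Lemma reading_observations e :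
  observations (draw n) delta (fun t => (signal e t)%:C%C)
    (fun w t => (reading e w t)%:C%C).
Proof.
split.
- apply: cmeasurable_real; exact: measurable_reading.
- exact: L2_reading.
- apply: aeW => t; split.
  + by split; exact: integrable_draw.
  + exact: cexpectation_reading.
  + rewrite /cvariance cexpectation_reading ge0_integral_draw; last first.
      by move=> w; rewrite lee_fin sqr_ge0.
    rewrite sumEFin -EFinM lee_fin.
    rewrite (eq_bigr (fun w : 'I__ => (reading e w t - signal e t) ^+ 2)).
      exact: reading_variance.
    by move=> w _; rewrite -rmorphB modulus_real real_normK// num_real.
- move=> p Lp pairing; split.
    by split; exact: integrable_draw.
  have py w := L2_mul_cintegrable Lp (L2_reading e w).
  rewrite [LHS]/cexpectation /pairing /cintegral /=; congr (_ +i* _)%C.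
  + apply: (etrans (@draw_Rintegral_exchange _ n _ (fun w => (py w).1))).
    apply: eq_Rintegral => t _; rewrite cexpectation_reading.
    rewrite Re_mul_real -(reading_unbiased delta k_lt e t) Rintegral_draw.
    rewrite [RHS]mulrCA; congr (_ * _); rewrite mulr_sumr.
    by under eq_bigr do rewrite Re_mul_real.
  + apply: (etrans (@draw_Rintegral_exchange _ n _ (fun w => (py w).2))).
    apply: eq_Rintegral => t _; rewrite cexpectation_reading.
    rewrite Im_mul_real -(reading_unbiased delta k_lt e t) Rintegral_draw.
    rewrite [RHS]mulrCA; congr (_ * _); rewrite mulr_sumr.
    by under eq_bigr do rewrite Im_mul_real.
- rewrite ge0_integral_draw; last first.
    by move=> w; apply: integral_ge0 => t _; rewrite lee_fin sqr_ge0.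
  have mr w : measurable_fun setT
      (fun t => (normc (reading e w t)%:C%C ^+ 2)%:E).
    apply/emeasurable_normc_sqr/cmeasurable_real; exact: measurable_reading_at.
  have r0 w t : (0 <= (normc (reading e w t)%:C%C ^+ 2)%:E)%E.
    by rewrite lee_fin sqr_ge0.
  have <- : (\int[leb]_t \sum_(w < n.+1) (normc (reading e w t)%:C%C ^+ 2)%:E =
      \sum_(w < n.+1) \int[leb]_t (normc (reading e w t)%:C%C ^+ 2)%:E)%E.
    by rewrite ge0_integral_sum// => w; exact: mr.
  rewrite -ge0_integralZl//; last 2 first.
  - by apply: emeasurable_sum => w; exact: mr.
  - by move=> t _; exact: sume_ge0.
  apply: eq_integral => t _; by rewrite ge0_integral_draw.
Qed.

End lower_bound.

Section random_signs_bound.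
Context {R : realType} (n : nat) (delta : R) (k : R -> nat) (s : R).
Notation leb := (@lebesgue_measure R).
Hypothesis k_measurable : measurable_fun setT k.
Hypothesis k_lt : forall t, (k t < n.+1)%N.
Hypothesis k_support : forall t, s < `|t| -> k t = 0%N.

(** The worst risk dominates the average over all sign patterns, and at each t a
    fraction 1 - k / (n + 1) of the draws hides the sign. *)
Lemma random_signs_bound (mu : R -> R[i]) (nu : R -> R)
    (phi : (R -> R[i]) -> R -> R[i]) :
  cmeasurable mu -> (forall x, L2 x -> L2 (phi x)) ->
  (\int[leb]_t (nu t * (delta ^+ 2 * ((k t)%:R / (n.+1 - k t)%:R)))%:E <= 1)%E ->
  (\int[leb]_t (normc (mu t) ^+ 2 * (delta ^+ 2 * ((k t)%:R / n.+1%:R)))%:E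
     <= ereal_sup (mean_square_errors mu nu delta phi))%E.
Proof.
move=> mmu phiL2 energy; set S := ereal_sup _.
pose signs := {ffun 'I_n.+1 -> bool}.
pose F (e : signs) (w : nat) (t : R) : R :=
  normc (mul_op mu (fun t => (signal delta k e t)%:C%C) t -
    phi (fun t => (reading delta k e w t)%:C%C) t) ^+ 2.
have F0 e w t : (0 <= (F e w t)%:E)%E by rewrite lee_fin sqr_ge0.
have mF e w : measurable_fun setT (fun t => (F e w t)%:E).
  apply/emeasurable_normc_sqr/cmeasurableB.
    apply: cmeasurableM => //; apply: cmeasurable_real; exact: measurable_signal.
  by apply: (proj1 (proj1 (L2P _) (phiL2 _ _))); apply: L2_reading k_support _ _.
have F_le_S e : (\int[draw n]_w \int[leb]_t (F e w t)%:E <= S)%E.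
  apply: ereal_sup_ubound; exists (fun t => (signal delta k e t)%:C%C).
  split.
    have energy_signal :
        (weighted_energy nu (fun t => (signal delta k e t)%:C%C) <= 1)%E.
      rewrite /weighted_energy; under eq_integral do
        rewrite modulus_real real_normK ?num_real// signal_sqr//.
      exact: energy.
    split=> //; split; first exact: L2_signal k_support _.
    exact: le_lt_trans energy_signal (ltry _).
  exists default_measure_display, nat, (draw n),
    (fun w t => (reading delta k e w t)%:C%C); split.
    exact: reading_observations k_support _.
  by apply: eq_integral => w _; rewrite L2norm_sqr.
pose M : R := #|signs|%:R.
have M0 : 0 < M.
  by rewrite ltr0n; apply/card_gt0P; exists [ffun=> false].
pose G t := normc (mu t) ^+ 2 * (delta ^+ 2 * ((k t)%:R / (n.+1 - k t)%:R)).
have G0 t : 0 <= G t by rewrite mulr_ge0 ?sqr_ge0// mulr_ge0 ?sqr_ge0// divr_ge0.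
have mkR (h : nat -> R) : measurable_fun setT (h \o k).
  exact: (@measurableT_comp _ _ _ _ _ _ h).
have mG : measurable_fun setT G.
  apply: measurable_funM; first exact: measurable_normc_sqr.
  exact: (mkR (fun j => delta ^+ 2 * (j%:R / (n.+1 - j)%:R))).
(* What hidden_sign_error guarantees, jointly in the draw and the point. *)
pose H (z : nat * R) : \bar R := (if (z.1 < k z.2)%N then 0 else M * G z.2)%:E.
have H0 z : (0 <= H z)%E.
  by rewrite lee_fin; case: ifP => // _; rewrite mulr_ge0// ltW.
have mH : measurable_fun setT H.
  apply/measurable_EFinP; apply: measurable_fun_ifT => //.
    apply: measurable_fun_ltn => //; exact: measurableT_comp.
  by apply: measurable_funM => //; exact: measurableT_comp.
rewrite -(@lee_pmul2l _ M%:E)//.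
have -> : (M%:E * S = \sum_(e : signs) S)%E.
  by rewrite sumr_const mule_natl.
apply: le_trans (lee_sum _ (fun e _ => F_le_S e)).
rewrite -ge0_integral_sum//; last first.
  by move=> e w _; apply: integral_ge0.
apply: (@le_trans _ _ (\int[draw n]_w \int[leb]_t H (w, t))%E).
  rewrite (@fubini_tonelli _ _ _ _ _ (draw n) leb H mH H0).
  rewrite -ge0_integralZl//; last 3 first.
  - apply/measurable_EFinP; apply: measurable_funM; first exact: measurable_normc_sqr.
    exact: (mkR (fun j => delta ^+ 2 * (j%:R / n.+1%:R))).
  - by move=> t _; rewrite lee_fin mulr_ge0 ?sqr_ge0// mulr_ge0 ?sqr_ge0// divr_ge0.
  - by rewrite lee_fin ltW.
  rewrite le_eqVlt; apply/orP; left; apply/eqP; apply: eq_integral => t _.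
  rewrite ge0_integral_draw// /H /= sumEFin -!EFinM; congr EFin.
  rewrite sum_threshold ?(ltnW (k_lt t))// mul0r add0r /G.
  field; rewrite -(natrD _ 1) !pnatr_eq0 subn_eq0 -ltnNge.
  by rewrite k_lt.
apply: ge0_le_integral => //.
  by move=> w _; exact: integral_ge0.
move=> w _; rewrite -ge0_integral_sum//; last by move=> e; exact: mF.
apply: ge0_le_integral => //.
- exact: (measurableT_comp mH (pair1_measurable w)).
- by apply: emeasurable_sum => e; exact: mF.
move=> t _; rewrite /H /= sumEFin lee_fin; case: ifP => [_|/negbT].
  by apply: sumr_ge0 => e _; exact: sqr_ge0.
rewrite -leqNgt => kw.
apply: le_trans (hidden_sign_error delta k_lt phi (mu t) kw).
by rewrite sumr_const -[X in _ <= X]mulr_natl.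
Qed.

End random_signs_bound.

(** * Least favorable signals *)

Lemma measurable_truncn (R : realType) :
  measurable_fun [set: R] (Num.truncn : R -> nat).
Proof.
move=> _ Y mY; rewrite setTI.
have -> : (Num.truncn : R -> nat) @^-1` Y = \bigcup_(i in Y)
    ([set x : R | x < i.+1%:R] `\` \bigcup_(j < i) [set x : R | x < j.+1%:R]).
  apply/seteqP; split=> x /=.
    move=> Yx; exists (Num.truncn x) => //; split; first exact: truncnS_gt.
    by move=> [j /= jx]; rewrite -truncn_le_nat leqNgt jx.
  move=> [i Yi [/=]]; rewrite -truncn_le_nat => xi ni.
  suff -> : Num.truncn x = i by [].
  apply/eqP; rewrite eqn_leq xi/= leqNgt; apply/negP => xi'; apply: ni.
  by exists (Num.truncn x) => //=; exact: truncnS_gt.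
apply: bigcup_measurable => i _; apply: measurableD.
  by rewrite -set_itvNyo; exact: measurable_itv.
apply: bigcup_measurable => j _.
by rewrite -set_itvNyo; exact: measurable_itv.
Qed.

Section least_favorable.
Context {R : realType} (mu : R -> R[i]) (nu : R -> R) (s delta : R).
Notation leb := (@lebesgue_measure R).
Hypothesis mu_continuous : continuous (mu : R -> R[i]^o).
Hypothesis nu_continuous : continuous nu.
Hypothesis nu_ge0 : forall t, 0 <= nu t.
Hypothesis mu_even : forall t, normc (mu (- t)) = normc (mu t).
Hypothesis nu_even : forall t, nu (- t) = nu t.
Hypothesis decreasing : quotient_decreasing mu nu.
Hypothesis s_gt0 : 0 < s.
Hypothesis delta_gt0 : 0 < delta.
Hypothesis level_s : level mu nu s = delta ^- 2.
Notation c := (quotient mu nu s).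
Notation damping := (damping mu nu s).

(** The probability k / (n + 1) of showing the signal at t approximates the
    damping factor from below.  The bound by n keeps this probability below 1,
    which matters at t = 0, where the damping factor may be 1. *)
Definition threshold (n : nat) (t : R) : nat :=
  if `|t| <= s then minn n (Num.truncn (n.+1%:R * damping t)) else 0%N.

Lemma threshold_lt n t : (threshold n t < n.+1)%N.
Proof. by rewrite /threshold; case: ifP => // _; rewrite ltnS geq_minl. Qed.

Lemma threshold_support n t : s < `|t| -> threshold n t = 0%N.
Proof. by rewrite /threshold ltNge => /negbTE ->. Qed.

Lemma measurable_threshold n : measurable_fun setT (threshold n).
Proof.
apply: measurable_fun_ifT => //.
  by apply: measurable_realfun.measurable_fun_ler => //; exact: measurableT_comp.
apply: (@measurableT_comp _ _ _ _ _ _ (minn n)) => //.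
apply: (measurableT_comp (@measurable_truncn R)).
by apply: measurable_funM => //; exact: measurable_damping.
Qed.

Lemma damping_ge0 t : `|t| <= s -> 0 <= damping t.
Proof.
move=> ts; have := quotient_sqrt_le mu_even nu_even decreasing s_gt0 ts.
have := modulus_ge0 (mu t); rewrite le_eqVlt => /predU1P[m0 _|m0 cm].
  by rewrite /damping -m0 invr0 mulr0 mul0r subr0.
by rewrite /damping subr_ge0 mulrAC ler_pdivrMr// mul1r mulrC.
Qed.

Lemma threshold_le n t : `|t| <= s -> (threshold n t)%:R <= n.+1%:R * damping t.
Proof.
move=> ts; rewrite /threshold ts.
have /truncn_itv/andP[+ _] : 0 <= n.+1%:R * damping t.
  by rewrite mulr_ge0 ?damping_ge0.
by apply: le_trans; rewrite ler_nat geq_minr.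
Qed.

Lemma damping_le1 t : damping t <= 1.
Proof.
rewrite gerBl mulr_ge0 ?quotient_ge0// divr_ge0 ?sqrtr_ge0//.
exact: modulus_ge0.
Qed.

Lemma threshold_ge n t : `|t| <= s -> n.+1%:R * damping t <= (threshold n t)%:R + 1.
Proof.
move=> ts; rewrite /threshold ts natr1 /minn; case: ifP => _.
  by rewrite ler_piMr// damping_le1.
exact/ltW/truncnS_gt.
Qed.

Lemma modulus_sqr_damping t :
  normc (mu t) ^+ 2 * damping t = normc (mu t) ^+ 2 - c * cross mu nu t.
Proof.
rewrite expr2 -mulrA [X in _ * X]mulrC mul_damping /cross.
by case: eqVneq => [->|_]; [rewrite !mul0r mulr0 subr0|ring].
Qed.

(** As k <= (n + 1) a with a = 1 - c sqrt nu / |mu|, the odds k / (n + 1 - k)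
    are at most a / (1 - a) = |mu| / (c sqrt nu) - 1. *)
Lemma threshold_energy n t : `|t| <= s ->
  nu t * ((threshold n t)%:R / (n.+1 - threshold n t)%:R) <=
  c^-1 * cross mu nu t - nu t.
Proof.
move=> ts; have c0 := quotient_gt0 decreasing s_gt0.
have cm := quotient_sqrt_le mu_even nu_even decreasing s_gt0 ts.
have kl := threshold_le n ts.
have kn : 0 < (n.+1 - threshold n t)%:R :> R by rewrite ltr0n subn_gt0 threshold_lt.
have NE : n.+1%:R = (n.+1 - threshold n t)%:R + (threshold n t)%:R :> R.
  by rewrite -natrD subnK// ltnW// threshold_lt.
have r0 := sqrtr_ge0 (nu t).
have nuE := sqr_sqrtr (nu_ge0 t).
move: kl cm r0; rewrite NE -[X in X * (_ / _)]nuE -[X in _ - X]nuE /cross /damping.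
move: (_ - _)%:R kn (threshold n t)%:R => M M0 K.
move: (Num.sqrt _) (normc _) (modulus_ge0 (mu t)) c c0 => r m m0 q q0 kl cm.
rewrite le_eqVlt => /predU1P[<-|r0]; first by rewrite expr0n !mul0r !mulr0 subr0.
have {}m0 : 0 < m by apply: lt_le_trans cm; rewrite mulr_gt0.
have : K * m <= (M + K) * (m - r * q).
  apply: le_trans (ler_wpM2r (ltW m0) kl) _.
  by rewrite le_eqVlt; apply/orP; left; apply/eqP; field; rewrite gt_eqF.
move=> {}kl; have {}kl : K * r * q <= M * (m - r * q) by lra.
rewrite -subr_ge0.
have -> : q^-1 * (m * r) - r ^+ 2 - r ^+ 2 * (K / M) =
    r * (M * (m - r * q) - K * r * q) / (M * q).
  by field; rewrite !gt_eqF.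
by rewrite divr_ge0 ?mulr_ge0 ?subr_ge0 // ltW.
Qed.

Lemma threshold_energy_integral n : (\int[leb]_t (nu t *
  (delta ^+ 2 * ((threshold n t)%:R / (n.+1 - threshold n t)%:R)))%:E <= 1)%E.
Proof.
pose f t := nu t * (delta ^+ 2 * ((threshold n t)%:R / (n.+1 - threshold n t)%:R)).
have cE := @excess_continuous _ _ _ mu_continuous nu_continuous c^-1.
have cdE := @continuous_scale _ (delta ^+ 2) _ cE.
rewrite (@integral_on_support _ f f s)//; last first.
  by move=> t /threshold_support; rewrite /f => ->; rewrite mul0r !mulr0.
have -> : 1%E = (\int[leb]_(t in [set t | (`|t| <= s)%R])
    (delta ^+ 2 * (c^-1 * cross mu nu t - nu t))%:E)%E.
  rewrite integral_sym_EFin// RintegralZl//; last 2 first.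
  - exact: measurable_sym.
  - exact: integrable_sym.
  by rewrite -levelE// level_s divff// expf_neq0// gt_eqF.
apply: ge0_le_integral.
- exact: measurable_sym.
- move=> t _; rewrite lee_fin /f mulr_ge0// mulr_ge0 ?sqr_ge0// divr_ge0//.
- apply/measurable_EFinP; apply: measurable_funTS; apply: measurable_funM.
    exact: continuous_measurable_fun.
  exact: (measurableT_comp (_ : measurable_fun setT (fun j : nat =>
    delta ^+ 2 * (j%:R / (n.+1 - j)%:R) : R)) (measurable_threshold n)).
- apply/measurable_EFinP; apply: measurable_funTS; exact: continuous_measurable_fun.
- move=> t ts; rewrite lee_fin /f mulrCA ler_wpM2l ?sqr_ge0//.
  exact: threshold_energy.
Qed.

Lemma optimal_value_ge0 : 0 <= optimal_value mu nu s.
Proof.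
apply: Rintegral_ge0 => t ts; rewrite -modulus_sqr_damping.
by rewrite mulr_ge0 ?sqr_ge0 ?damping_ge0.
Qed.

(** Rounding to multiples of 1 / (n + 1) loses at most 1 / (n + 1) of |mu|^2 at
    each point of [-s, s]. *)
Lemma discretized_error_ge (phi : (R -> R[i]) -> R -> R[i]) n :
  (forall x, L2 x -> L2 (phi x)) ->
  ((delta ^+ 2 * optimal_value mu nu s)%:E <=
   ereal_sup (mean_square_errors mu nu delta phi) +
   (delta ^+ 2 / n.+1%:R *
     \int[leb]_(t in [set t | `|t| <= s]) normc (mu t) ^+ 2)%:E)%E.
Proof.
move=> phiL2.
have := random_signs_bound (measurable_threshold n)
  (threshold_lt n) (@threshold_support n) (continuous_cmeasurable mu_continuous)
  phiL2 (threshold_energy_integral n).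
pose f t := normc (mu t) ^+ 2 * (delta ^+ 2 * ((threshold n t)%:R / n.+1%:R)).
have f0 t : 0 <= f t by rewrite mulr_ge0 ?sqr_ge0// mulr_ge0 ?sqr_ge0// divr_ge0.
have mf : measurable_fun setT f.
  apply: measurable_funM.
    exact/measurable_normc_sqr/continuous_cmeasurable.
  exact: (measurableT_comp (_ : measurable_fun setT (fun j : nat =>
    delta ^+ 2 * (j%:R / n.+1%:R) : R)) (measurable_threshold n)).
rewrite (@integral_on_support _ f f s)//; last first.
  by move=> t /threshold_support; rewrite /f => ->; rewrite mul0r !mulr0.
move=> bound; apply: le_trans (leeD2r _ bound).
have cM := modulus_sqr_continuous mu_continuous.
have cC := cross_continuous mu_continuous nu_continuous.
have cV := continuous_sub cM (@continuous_scale _ c _ cC).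
rewrite /optimal_value -!RintegralZl//; do ?exact: measurable_sym;
  do ?exact: integrable_sym.
rewrite -!integral_sym_EFin; last 2 first.
- exact: (@continuous_scale _ (delta ^+ 2 / n.+1%:R) _ cM).
- exact: (@continuous_scale _ (delta ^+ 2) _ cV).
rewrite -ge0_integralD//; last 5 first.
- exact: measurable_sym.
- by move=> t _; rewrite lee_fin.
- by apply/measurable_EFinP; apply: measurable_funTS.
- by move=> t _; rewrite lee_fin mulr_ge0 ?sqr_ge0// divr_ge0 ?sqr_ge0.
- apply/measurable_EFinP; apply: measurable_funTS; apply: continuous_measurable_fun.
  exact: (@continuous_scale _ (delta ^+ 2 / n.+1%:R) _ cM).
apply: ge0_le_integral.
- exact: measurable_sym.
- move=> t ts; rewrite lee_fin -modulus_sqr_damping.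
  by rewrite mulr_ge0 ?sqr_ge0// mulr_ge0 ?sqr_ge0 ?damping_ge0.
- apply/measurable_EFinP; apply: measurable_funTS; apply: continuous_measurable_fun.
  exact: (@continuous_scale _ (delta ^+ 2) _ cV).
- apply: emeasurable_funD; apply/measurable_EFinP; apply: measurable_funTS => //.
  apply: continuous_measurable_fun.
  exact: (@continuous_scale _ (delta ^+ 2 / n.+1%:R) _ cM).
- move=> t ts; rewrite -EFinD lee_fin -modulus_sqr_damping /f.
  have -> : normc (mu t) ^+ 2 * (delta ^+ 2 * ((threshold n t)%:R / n.+1%:R)) +
    delta ^+ 2 / n.+1%:R * normc (mu t) ^+ 2 =
    delta ^+ 2 * (normc (mu t) ^+ 2 * (((threshold n t)%:R + 1) / n.+1%:R)).
    by rewrite mulrDl mul1r; ring.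
  rewrite !ler_wpM2l ?sqr_ge0// ler_pdivlMr ?ltr0n// mulrC.
  exact: threshold_ge.
Qed.

Lemma recovery_error_ge (phi : (R -> R[i]) -> R -> R[i]) :
  (forall x, L2 x -> L2 (phi x)) ->
  ((delta ^+ 2 * optimal_value mu nu s)%:E <=
   ereal_sup (mean_square_errors mu nu delta phi))%E.
Proof.
move=> phiL2; apply/lee_addgt0Pr => e e0.
set J := \int[leb]_(t in [set t | `|t| <= s]) normc (mu t) ^+ 2.
pose n := Num.truncn (delta ^+ 2 * J / e).
apply: le_trans (discretized_error_ge n phiL2) _.
rewrite leeD2l// lee_fin -/J mulrAC ler_pdivrMr ?ltr0n// [leRHS]mulrC -ler_pdivrMr//.
exact/ltW/truncnS_gt.
Qed.

End least_favorable.

(** * Optimal recovery *)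

Theorem theorem1 (R : realType) (mu : R -> R[i]) (nu : R -> R)
    (mu_continuous : continuous (mu : R -> R[i]^o))
    (nu_continuous : continuous nu)
    (nu_ge0 : forall t, 0 <= nu t)
    (mu_even : forall t, normc (mu (- t)) = normc (mu t))
    (nu_even : forall t, nu (- t) = nu t)
    (mu_pos : {ae lebesgue_measure, forall t : R, 0 < normc (mu t)})
    (nu_pos : {ae lebesgue_measure, forall t : R, 0 < nu t})
    (decreasing : quotient_decreasing mu nu)
    (mu_maps : forall x, weighted_space nu x -> L2 (mul_op mu x))
    (level_infty : level mu nu s @[s --> +oo%R] --> +oo%R)
    (delta : R) (delta_gt0 : 0 < delta) :
  exists t_delta : R,
    [/\ 0 < t_delta /\ level mu nu t_delta = delta ^- 2,
        forall s, 0 < s -> level mu nu s = delta ^- 2 -> s = t_delta,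
        optimal_error mu nu delta =
          (delta * Num.sqrt (\int[lebesgue_measure]_(t in [set t | `|t| <= t_delta])
             (normc (mu t) ^+ 2 *
              (1 - Num.sqrt (nu t) / normc (mu t) *
                   (normc (mu t_delta) / Num.sqrt (nu t_delta))))))%:E &
        optimal_method mu nu delta
          (fun (y : R -> R[i]) (t : R) =>
             (Num.max (1 - Num.sqrt (nu t) / normc (mu t) *
                           (normc (mu t_delta) / Num.sqrt (nu t_delta))) 0)%:C%C
             * mu t * y t)].
Proof.
have v0 : 0 < delta ^- 2 by rewrite invr_gt0 exprn_gt0.
have [s [s0 fs uniq_s]] := level_root mu_continuous nu_continuous nu_ge0 mu_even
  nu_even decreasing level_infty v0.
exists s.
pose I := optimal_value mu nu s.
have I0 : 0 <= I by exact: optimal_value_ge0.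
have V0 : (0 <= (delta ^+ 2 * I)%:E)%E by rewrite lee_fin mulr_ge0 ?sqr_ge0.
have sqrtV : sqrte (delta ^+ 2 * I)%:E = (delta * Num.sqrt I)%:E.
  by rewrite /= sqrtrM ?sqr_ge0// sqrtr_sqr gtr0_norm.
have lower phi : recovery_method phi ->
    ((delta * Num.sqrt I)%:E <= method_error mu nu delta phi)%E.
  move=> [phiL2 _].
  have le_sup := recovery_error_ge mu_continuous nu_continuous nu_ge0 mu_even
    nu_even decreasing s0 delta_gt0 fs phiL2.
  rewrite /method_error poweR12_sqrt; last exact: le_trans V0 le_sup.
  by rewrite -sqrtV lee_sqrt// (le_trans V0).
have rec := shrink_recovery mu_continuous nu_continuous mu_even nu_even
  decreasing s0.
have upper :
    (method_error mu nu delta (shrink mu nu s) <= (delta * Num.sqrt I)%:E)%E.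
  have sup_le := shrink_error mu_continuous nu_continuous nu_ge0 mu_even
    nu_even decreasing s0 delta_gt0 fs.
  have le_sup := recovery_error_ge mu_continuous nu_continuous nu_ge0 mu_even
    nu_even decreasing s0 delta_gt0 fs (proj1 rec).
  rewrite /method_error poweR12_sqrt; last exact: le_trans V0 le_sup.
  by rewrite -sqrtV lee_sqrt.
have value : optimal_error mu nu delta = (delta * Num.sqrt I)%:E.
  apply/le_anti/andP; split.
    apply: ge_ereal_inf.
    by exists (method_error mu nu delta (shrink mu nu s)) => //; exists (shrink mu nu s).
  by apply/ereal_infP => _ [phi rphi <-]; exact: lower.
split => //.
- rewrite value; congr (_ * Num.sqrt _)%:E; apply: eq_Rintegral => t _.
  by rewrite -modulus_sqr_damping.
- split; first exact: rec.
  rewrite value; apply/le_anti/andP; split; first exact: upper.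
  exact: lower.
Qed.
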